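(* Let $(X_N)_{N\in\mathbb{N}}$ be a self-adjoint random matrix ensemble and let $M>0$, $K>0$ be constants such that: (i) for all $m,n\in\mathbb{N}$ the limits $\alpha_n=\lim_{N\to\infty}\frac1N\mathbb{E}(\mathrm{Tr}(X_N^n))$ and $\alpha_{m,n}=\lim_{N\to\infty}\mathrm{Cov}(\mathrm{Tr}(X_N^m),\mathrm{Tr}(X_N^n))$ exist; (ii) $\lim_{N\to\infty}N^8\,\mathbb{P}(\|X_N\|>M)=0$; (iii) for all $f\in C^1(\mathbb{R})$ and $N\in\mathbb{N}$, $\mathrm{Var}(\mathrm{Tr}(f(X_N)))\le K\|f'\|_\infty^2$. Let $\rho$ be the associated asymptotic covariance map on $C^1([-M,M])\times C^1([-M,M])$. Then for every $z,w\in\mathbb{C}\setminus\mathbb{R}$, $$\rho(r_z,r_w)=\lim_{N\to\infty}\mathrm{Cov}\left(\mathrm{Tr}((z-X_N)^{-1}),\mathrm{Tr}((w-X_N)^{-1})\right),$$ where $r_z(x)=\frac{1}{z-x}$ (restricted to $[-M,M]$ as an argument of $\rho$).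
   Context: A self-adjoint random matrix ensemble $(X_N)_{N}$ is a sequence in which $X_N$ is an $N\times N$ self-adjoint complex random matrix; all moments $\mathbb{E}(\mathrm{Tr}(X_N^n))$ and covariances $\mathrm{Cov}(\mathrm{Tr}(X_N^m),\mathrm{Tr}(X_N^n))$ are assumed finite. $\|X_N\|$ is the operator norm; $\mathrm{Tr}$ is the unnormalized trace; $\mathrm{Tr}(f(X_N))=\sum_k f(\lambda_k)$, with $\lambda_1,\dots,\lambda_N$ the eigenvalues of $X_N$. $\mathrm{Cov}(X,Y)=\mathbb{E}(XY)-\mathbb{E}(X)\mathbb{E}(Y)$ (no complex conjugation) and $\mathrm{Var}(X)=\mathbb{E}|X-\mathbb{E}X|^2$ for complex random variables. $C^1(\mathbb{R})$ is the space of complex-valued functions on $\mathbb{R}$ with continuous derivative; $C^1([-M,M])$ is the space of restrictions of such functions to $[-M,M]$; $\|h\|_M=\sup_{|x|\le M}|h(x)|$; $\|h\|_\infty=\sup_{x\in\mathbb{R}}|h(x)|$. The asymptotic covariance map $\rho:C^1([-M,M])\times C^1([-M,M])\to\mathbb{C}$ is the unique bilinear map such that $\rho(x^m,x^n)=\alpha_{m,n}$ for $m,n\ge1$, $\rho(1,f)=\rho(f,1)=0$ for all $f$, and $|\rho(f,g)|\le K\|f'\|_M\|g'\|_M$ for all $f,g\in C^1([-M,M])$ (it is obtained by continuous extension from polynomials, which are dense). *)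

(* Defs.v *)
From HB Require Import structures.
From mathcomp Require Import all_boot all_order all_algebra.
From mathcomp Require Import all_classical all_reals all_analysis.
From mathcomp Require Import spectral complex.

Set Implicit Arguments.
Unset Strict Implicit.
Unset Printing Implicit Defensive.

Import Order.TTheory GRing.Theory Num.Theory.
Import numFieldNormedType.Exports.

Local Open Scope classical_set_scope.
Local Open Scope ring_scope.
Local Open Scope complex_scope.

Section Functions.
Context (R : realType).
Implicit Types (f g : R -> R[i]) (A : set R) (M K : R).

Definition cderiv f (x : R) : R[i] :=
  derive1 (fun t => complex.Re (f t)) x +i* derive1 (fun t => complex.Im (f t)) x.

Definition C1 f : Prop :=
  [/\ forall x, derivable (fun t => complex.Re (f t)) x 1,
      forall x, derivable (fun t => complex.Im (f t)) x 1,
      continuous (derive1 (fun t => complex.Re (f t))) &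
      continuous (derive1 (fun t => complex.Im (f t)))].

(* Extended-real valued: the supremum over all of R may be infinite. *)
Definition supnorm A f : \bar R :=
  ereal_sup [set (Normc.normc (f x))%:E | x in A].

Definition seg M : set R := `[- M, M].

Definition segfun M := set_type (seg M) -> R[i].

Definition restr M f : segfun M := sigL (seg M) f.
Arguments restr M f : clear implicits.

Definition C1seg M (h : segfun M) : Prop := exists2 f, C1 f & h = restr M f.

Definition monomial (n : nat) (x : R) : R[i] := (x ^+ n)%:C.

Definition resolvent (z : R[i]) (x : R) : R[i] := 1 / (z - x%:C).

(* rho is a function on all of segfun M, but only its values on C^1([-M, M])
   matter, and only these are constrained.  In the bound, f and g are arbitrary
   C^1 extensions of the arguments; since 0 < M, their derivatives on [-M, M]
   are determined by the arguments. *)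
Definition asymptotic_covariance M K (alpha : nat -> nat -> R[i])
    (rho : segfun M -> segfun M -> R[i]) : Prop :=
  [/\ forall (a : R[i]) (h1 h2 h : segfun M), C1seg h1 -> C1seg h2 -> C1seg h ->
        rho (fun x => a * h1 x + h2 x) h = a * rho h1 h + rho h2 h /\
        rho h (fun x => a * h1 x + h2 x) = a * rho h h1 + rho h h2,
      forall m n, (1 <= m)%N -> (1 <= n)%N ->
        rho (restr M (monomial m)) (restr M (monomial n)) = alpha m n,
      forall h : segfun M, C1seg h -> rho (fun=> 1) h = 0 /\ rho h (fun=> 1) = 0 &
      forall f g, C1 f -> C1 g ->
        ((Normc.normc (rho (restr M f) (restr M g)))%:E <=
          K%:E * supnorm (seg M) (cderiv f) * supnorm (seg M) (cderiv g))%E].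

End Functions.
Arguments restr {R} M f.

Section Matrices.
Context (R : realType).

(* For Hermitian A, the entries of spectral_diag A are the eigenvalues of A
   counted with multiplicity, and they are real. *)
Definition trace_fun n (f : R -> R[i]) (A : 'M[R[i]]_n) : R[i] :=
  \sum_(k < n) f (complex.Re (spectral_diag A 0 k)).

Definition euclidean_norm n (v : 'cV[R[i]]_n) : R :=
  Num.sqrt (\sum_(k < n) Normc.normc (v k 0) ^+ 2).

Definition opnorm n (A : 'M[R[i]]_n) : R :=
  sup [set euclidean_norm (A *m v) | v in [set v | euclidean_norm v <= 1]].

End Matrices.

Section Probability.
Context (R : realType) (d : measure_display) (T : measurableType d).
Context (P : probability T R).
Implicit Types f g : T -> R[i].

Definition cintegrable f : Prop :=
  P.-integrable setT (fun w => (complex.Re (f w))%:E) /\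
  P.-integrable setT (fun w => (complex.Im (f w))%:E).

Definition cexpect f : R[i] :=
  fine 'E_P[fun w => complex.Re (f w)] +i* fine 'E_P[fun w => complex.Im (f w)].

Definition ccov f g : R[i] :=
  cexpect (fun w => f w * g w) - cexpect f * cexpect g.

Definition cvar f : \bar R := 'E_P[fun w => Normc.normc (f w - cexpect f) ^+ 2].

Definition measurable_mx m n (X : T -> 'M[R[i]]_(m, n)) : Prop :=
  forall i j, measurable_fun setT (fun w => complex.Re (X w i j)) /\
              measurable_fun setT (fun w => complex.Im (X w i j)).

End Probability.

(* The matrices may live on different probability spaces.  The index N = 0 is
   the empty matrix, which imposes no condition. *)
Definition self_adjoint_ensemble (R : realType) (d : nat -> measure_display)
    (T : forall N, measurableType (d N)) (P : forall N, probability (T N) R)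
    (X : forall N, T N -> 'M[R[i]]_N) : Prop :=
  [/\ forall N, measurable_mx (X N),
      forall N w, X N w \is hermsymmx,
      forall N n, cintegrable (P N) (fun w => \tr (X N w ^+ n)) &
      forall N m n,
        cintegrable (P N) (fun w => \tr (X N w ^+ m) * \tr (X N w ^+ n))].

(* Main.v *)
(** The key estimate compares the trace [Y] of the resolvent with a polynomial
    linear statistic [S].  Expanding [r_z] in a geometric series around a point
    far from [z] on the other side of the real axis gives a polynomial [p] with
    [|(r_z - p)'| <= e] on [[- M, M]].  Extending [r_z - p] linearly outside
    [[- M, M]] and applying the variance bound shows that [Y - S] is within [K e^2]
    of a constant in mean square, up to the event [||X_N|| > M].  There the mean
    squares are [O(N^-2)], because the fourth moments of the traces are [O(N^4)]
    and the event has probability [O(N^-8)].  Hence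
    [Cov(Y, Y')] differs from [Cov(S, S')] by [O(e)] uniformly in large [N], while
    [Cov(S, S')] tends to [rho(p, q)], which is itself within [O(e)] of
    [rho(r_z, r_w)]. *)

Require Import Defs.
From HB Require Import structures.
From mathcomp Require Import all_boot all_order all_algebra.
From mathcomp Require Import all_classical all_reals all_analysis.
From mathcomp Require Import measurable_realfun spectral complex.
From mathcomp Require Import ring lra.

Import Order.TTheory GRing.Theory Num.Theory.
Import numFieldNormedType.Exports.

Local Open Scope classical_set_scope.
Local Open Scope ring_scope.
Local Open Scope complex_scope.

(** * Hermitian matrices and their eigenvalues *)

(** Two obstacles shape the proof. First, a polynomial has in general an unbounded derivative on the
    line, so the variance bound says nothing about its trace. The tangent extension freezes the
    derivative at its endpoint values, hence the bound on [-M, M] becomes a bound on R. In exchange,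
    the statistics agree only off the event of large norm, and the constant around which the
    difference concentrates is not known. It is controlled because the complement of the event has
    probability at least 1/2.

    Second, eigenvalues come from a diagonalisation and no measurability is established for them.
    The random variables that are integrated are therefore written through the entries: powers by
    their traces, resolvents by Cramer's rule, and the event by traces of even powers. The trace of
    the tangent extension enters only through an inequality between lower integrals. *)

Section Normc.
Context {R : rcfType}.
Implicit Types x y : R[i].

Lemma normc_ge0 x : 0 <= Normc.normc x.
Proof. by case: x => a b; exact: sqrtr_ge0. Qed.

Lemma normc_sqr x : Normc.normc x ^+ 2 = complex.Re x ^+ 2 + complex.Im x ^+ 2.
Proof. by case: x => a b; rewrite sqr_sqrtr// addr_ge0// sqr_ge0. Qed.

Lemma normr_normc x : `|x| = (Normc.normc x)%:C.
Proof. by rewrite normc_def; case: x. Qed.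

Lemma normc_real (a : R) : Normc.normc a%:C = `|a|.
Proof. by rewrite /= expr0n /= addr0 sqrtr_sqr. Qed.

Lemma ler_normcD x y : Normc.normc (x + y) <= Normc.normc x + Normc.normc y.
Proof. exact: le_normcD. Qed.

Lemma ler_normcB x y : Normc.normc (x - y) <= Normc.normc x + Normc.normc y.
Proof. by rewrite -(normcN y) ler_normcD. Qed.

Lemma normc_sqrD x y :
  Normc.normc (x + y) ^+ 2 <= 2 * (Normc.normc x ^+ 2 + Normc.normc y ^+ 2).
Proof.
rewrite !normc_sqr; case: x y => [a b] [c e] /=.
have := sqr_ge0 (a - c); have := sqr_ge0 (b - e); nra.
Qed.

Lemma ler_normRe x : `|complex.Re x| <= Normc.normc x.
Proof.
rewrite -(@ler_pXn2r _ 2)// ?nnegrE ?normc_ge0//.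
by rewrite normc_sqr real_normK ?num_real// lerDl sqr_ge0.
Qed.

Lemma ler_normIm x : `|complex.Im x| <= Normc.normc x.
Proof.
rewrite -(@ler_pXn2r _ 2)// ?nnegrE ?normc_ge0//.
by rewrite normc_sqr real_normK ?num_real// lerDr sqr_ge0.
Qed.

Lemma normc_le_ReIm x : Normc.normc x <= `|complex.Re x| + `|complex.Im x|.
Proof.
rewrite -(@ler_pXn2r _ 2)// ?nnegrE ?normc_ge0 ?addr_ge0//.
rewrite normc_sqr sqrrD !real_normK ?num_real// -addrA lerD2l lerDr.
by rewrite mulrn_wge0// mulr_ge0.
Qed.

Lemma normcX x n : Normc.normc (x ^+ n) = Normc.normc x ^+ n.
Proof. by elim: n => [|n IH]; rewrite ?Normc.normc1// !exprS Normc.normcM IH. Qed.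

Lemma ler_normc_sum (I : Type) (r : seq I) (P : pred I) (F : I -> R[i]) :
  Normc.normc (\sum_(i <- r | P i) F i) <= \sum_(i <- r | P i) Normc.normc (F i).
Proof.
elim/big_ind2: _ => [|x a y b xa yb|//]; first by rewrite Normc.normc0.
by rewrite (le_trans (ler_normcD _ _))// lerD.
Qed.

Lemma subC_neq0 (z : R[i]) (x : R) : complex.Im z != 0 -> z - x%:C != 0.
Proof.
case: z => a b /= b0; rewrite eq_complex /= negb_and.
by apply/orP; right; rewrite oppr0 addr0.
Qed.

Lemma normc_subC_ge (z : R[i]) (x : R) :
  `|complex.Im z| <= Normc.normc (z - x%:C).
Proof.
by apply: le_trans (ler_normIm _); case: z => a b /=; rewrite oppr0 addr0.
Qed.

End Normc.

Section Spectral.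
Context {R : realType}.
Context {n : nat} {A : 'M[R[i]]_n}.
Hypothesis hermA : A \is hermsymmx.

Definition eigval (k : 'I_n) : R := complex.Re (spectral_diag A 0 k).

Let U := spectralmx A.
Let D : 'rV[R[i]]_n := \row_k (eigval k)%:C.

Lemma spectral_decomposition : A = invmx U *m diag_mx D *m U.
Proof.
have /orthomx_spectralP {1}-> := hermitian_normalmx hermA.
congr (_ *m diag_mx _ *m _); apply/rowP => k; rewrite mxE.
by rewrite RRe_real//; exact: (mxOverP (hermitian_spectral_diag_real hermA)).
Qed.

Lemma conj_spectral (B : 'M[R[i]]_n) : \tr (invmx U *m B *m U) = \tr B.
Proof. by rewrite mxtrace_mulC mulmxA mulmxV ?spectral_unit// mul1mx. Qed.

Lemma expmx_spectral m :
  A ^+ m = invmx U *m diag_mx (\row_k ((eigval k) ^+ m)%:C) *m U.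
Proof.
elim: m => [|m IH].
  have -> : diag_mx (\row_k ((eigval k) ^+ 0)%:C) = 1%:M :> 'M[R[i]]_n.
    by apply/matrixP => i j; rewrite !mxE expr0.
  by rewrite mulmx1 mulVmx ?spectral_unit.
rewrite exprS IH {1}spectral_decomposition -mulmxE.
rewrite !mulmxA mulmxK ?spectral_unit//; congr (_ *m _).
rewrite -!mulmxA; congr (_ *m _); rewrite mulmx_diag; congr diag_mx.
by apply/rowP => k; rewrite !mxE exprS rmorphM.
Qed.

Lemma mxtrace_exp m : \tr (A ^+ m) = (\sum_k (eigval k) ^+ m)%:C.
Proof.
rewrite expmx_spectral conj_spectral mxtrace_diag rmorph_sum.
by apply: eq_bigr => k _; rewrite mxE.
Qed.

Section Resolvent.
Context {z : R[i]}.
Hypothesis z_nonreal : complex.Im z != 0.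

Let r : 'rV[R[i]]_n := \row_k (z - (eigval k)%:C)^-1.

(** The inverse is exhibited in the eigenbasis, so that both the invertibility of [z%:M - A] and the
    trace of its inverse can be read off. *)
Lemma subscal_spectral :
  (z%:M - A) *m (invmx U *m diag_mx r *m U) = 1%:M.
Proof.
have -> : z%:M - A = invmx U *m diag_mx (\row_k (z - (eigval k)%:C)) *m U.
  have -> : diag_mx (\row_k (z - (eigval k)%:C)) = z%:M - diag_mx D.
    apply/matrixP => i j; rewrite !mxE.
    by case: eqP => //= _; rewrite ?mulr1n ?mulr0n ?subr0.
  rewrite mulmxBr mulmxBl -spectral_decomposition; congr (_ - _).
  by rewrite -scalemx1 -scalemxAr mulmx1 -scalemxAl mulVmx ?spectral_unit.
rewrite !mulmxA mulmxK ?spectral_unit// -[X in X *m _]mulmxA mulmx_diag.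
have -> : diag_mx (\row_j ((\row_k (z - (eigval k)%:C)) 0 j * r 0 j)) = 1%:M
    :> 'M[R[i]]_n.
  by apply/matrixP => i j; rewrite !mxE divff// subC_neq0.
by rewrite mulmx1 mulVmx ?spectral_unit.
Qed.

Lemma subscal_unit : z%:M - A \in unitmx.
Proof. by have /mulmx1_unit[] := subscal_spectral. Qed.

Lemma mxtrace_resolvent : \tr (invmx (z%:M - A)) = trace_fun (resolvent z) A.
Proof.
have -> : invmx (z%:M - A) = invmx U *m diag_mx r *m U.
  by rewrite -[LHS]mulmx1 -subscal_spectral mulKmx// subscal_unit.
rewrite conj_spectral mxtrace_diag; apply: eq_bigr => k _.
by rewrite mxE /resolvent div1r.
Qed.

End Resolvent.

End Spectral.
Arguments eigval {R n} A k.

Section OperatorNorm.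
Context {R : realType}.
Local Open Scope sesquilinear_scope.

Lemma euclidean_norm_ge0 n (v : 'cV[R[i]]_n) : 0 <= euclidean_norm v.
Proof. exact: sqrtr_ge0. Qed.

Lemma euclidean_norm_sqr n (v : 'cV[R[i]]_n) :
  euclidean_norm v ^+ 2 = \sum_k Normc.normc (v k 0) ^+ 2.
Proof. by rewrite sqr_sqrtr// sumr_ge0// => k _; exact: sqr_ge0. Qed.

Lemma euclidean_norm_sqrC n (v : 'cV[R[i]]_n) :
  (euclidean_norm v ^+ 2)%:C = (v ^t* *m v) 0 0.
Proof.
rewrite euclidean_norm_sqr rmorph_sum mxE; apply: eq_bigr => k _ /=.
by rewrite !mxE rmorphXn /= -normr_normc normCK mulrC.
Qed.

Lemma euclidean_norm_unitary {n} {V : 'M[R[i]]_n} (v : 'cV[R[i]]_n) :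
  V \is unitarymx -> euclidean_norm (V *m v) = euclidean_norm v.
Proof.
move=> uV; apply/eqP; rewrite -(@eqrXn2 _ 2)// ?euclidean_norm_ge0//.
apply/eqP; apply: (@complexI R); rewrite !euclidean_norm_sqrC.
rewrite trmx_mul map_mxM -mulmxA [V ^t* *m _]mulmxA -invmx_unitary//.
by rewrite mulVmx ?unitarymx_unit// mul1mx.
Qed.

Context {n : nat} {A : 'M[R[i]]_n}.
Hypothesis hermA : A \is hermsymmx.

Let U := spectralmx A.

Lemma euclidean_norm_spectral (v : 'cV[R[i]]_n) :
  euclidean_norm (A *m v) ^+ 2 =
  \sum_k eigval A k ^+ 2 * Normc.normc ((U *m v) k 0) ^+ 2.
Proof.
have uU : U \is unitarymx by exact: spectral_unitarymx.
rewrite {1}(spectral_decomposition hermA) -!mulmxA euclidean_norm_unitary; last first.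
  by rewrite invmx_unitary// trmxC_unitary.
rewrite euclidean_norm_sqr; apply: eq_bigr => k _.
by rewrite mul_diag_mx !mxE Normc.normcM normc_real exprMn real_normK ?num_real// mxE.
Qed.

Let opset := [set euclidean_norm (A *m v) | v in [set v | euclidean_norm v <= 1]].

Lemma opnorm_ub (B : R) : 0 <= B -> (forall k, `|eigval A k| <= B) ->
  ubound opset B.
Proof.
move=> B0 AB _ [v /= v1 <-].
rewrite -(@ler_pXn2r _ 2) ?nnegrE ?euclidean_norm_ge0//.
rewrite euclidean_norm_spectral.
apply: (@le_trans _ _ (\sum_k B ^+ 2 * Normc.normc ((U *m v) k 0) ^+ 2)).
  apply: ler_sum => k _; apply: ler_wpM2r; first exact: sqr_ge0.
  by rewrite -real_normK ?num_real// ler_pXn2r ?nnegrE.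
rewrite -mulr_sumr -euclidean_norm_sqr euclidean_norm_unitary; last first.
  exact: spectral_unitarymx.
by rewrite ler_piMr ?sqr_ge0// expr_le1// euclidean_norm_ge0.
Qed.

Lemma opnorm_leP (B : R) : 0 <= B ->
  reflect (forall k, `|eigval A k| <= B) (opnorm A <= B).
Proof.
move=> B0; apply: (iffP idP) => [AB k|AB]; last first.
  apply: ge_sup; last exact: opnorm_ub.
  by exists (euclidean_norm (A *m 0)), 0 => //=; rewrite /euclidean_norm big1 ?sqrtr0//
    => k _; rewrite mxE Normc.normc0 expr0n.
apply: le_trans AB; apply: ub_le_sup.
  (* A supremum dominates its members only when the set is bounded; the sum of all [|eigval A j|] is
     a convenient bound. *)
  exists (\sum_j `|eigval A j|); apply: opnorm_ub; first exact: sumr_ge0.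
  by move=> j; rewrite (bigD1 j)//= lerDl sumr_ge0.
(* A unit eigenvector for [eigval A k], at which the norm of the image is exactly [|eigval A k|]. *)
pose v : 'cV[R[i]]_n := invmx U *m delta_mx k 0.
have vE : U *m v = delta_mx k 0 by rewrite mulKVmx// spectral_unit.
have nE j : Normc.normc ((U *m v) j 0) ^+ 2 = (j == k)%:R.
  rewrite vE !mxE andbT.
  by case: eqP => _; rewrite ?Normc.normc1 ?Normc.normc0 ?expr1n ?expr0n.
exists v => /=.
  rewrite -(euclidean_norm_unitary v (spectral_unitarymx A)) -/U.
  rewrite -(@expr_le1 _ 2) ?euclidean_norm_ge0// euclidean_norm_sqr.
  rewrite (bigD1 k)//= nE eqxx big1 ?addr0// => j jk.
  by rewrite nE (negbTE jk).
apply/eqP; rewrite -(@eqrXn2 _ 2)// ?euclidean_norm_ge0//.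
rewrite euclidean_norm_spectral (bigD1 k)//= nE eqxx mulr1 big1 ?addr0//.
  by rewrite real_normK ?num_real.
by move=> j jk; rewrite nE (negbTE jk) mulr0.
Qed.

(** Replaces a supremum over vectors by countably many conditions on traces, which are measurable in
    the matrix. If some eigenvalue exceeds [B] in modulus, its high even powers outgrow
    [n%:R * B ^+ m.*2], and the other eigenvalues contribute nonnegative terms to the trace. *)
Lemma opnorm_gtE (B : R) : 0 < B ->
  (B < opnorm A) <->
  exists m, n%:R * B ^+ m.*2 < complex.Re (\tr (A ^+ m.*2)).
Proof.
move=> B0; split.
  move=> AB; have /existsP[k Bk] : [exists k, B < `|eigval A k|].
    rewrite -[X in is_true X]negbK negb_exists; apply/negP => /forallP Ak.
    move: AB; rewrite ltNge => /negP; apply.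
    by apply/(opnorm_leP _ (ltW B0)) => k; rewrite leNgt.
  have Ak0 : 0 < `|eigval A k| by exact: lt_trans Bk.
  have q1 : `|(B / `|eigval A k|) ^+ 2| < 1.
    rewrite normrX expr_lt1// ger0_norm ?divr_ge0 ?ltW//.
    by rewrite ltr_pdivrMr// mul1r.
  have /cvgrPdist_lt/(_ n.+1%:R^-1) := cvg_expr q1.
  rewrite invr_gt0 ltr0Sn => /(_ isT)[m _ /(_ m (leqnn m))] /=.
  rewrite sub0r normrN ger0_norm; last by rewrite exprn_ge0// sqr_ge0.
  rewrite -exprM mul2n expr_div_n ltr_pdivrMr ?exprn_gt0// mulrC.
  rewrite ltr_pdivlMr ?ltr0Sn// => qm; exists m.
  rewrite mxtrace_exp//=; apply: (@lt_le_trans _ _ (`|eigval A k| ^+ m.*2)).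
    apply: le_lt_trans qm; rewrite mulrC ler_wpM2l ?exprn_ge0 ?ltW//.
    by rewrite ltr_nat.
  have e0 j : 0 <= eigval A j ^+ m.*2 by rewrite exprn_even_ge0// odd_double.
  by rewrite -normrX ger0_norm// (bigD1 k)//= lerDl sumr_ge0.
case=> m; rewrite mxtrace_exp//= => Bm; rewrite ltNge; apply/negP.
move=> /(opnorm_leP _ (ltW B0)) Ak; move: Bm; rewrite ltNge => /negP; apply.
have -> : n%:R * B ^+ m.*2 = \sum_(k < n) B ^+ m.*2.
  by rewrite sumr_const card_ord mulr_natl.
apply: ler_sum => k _.
rewrite -mul2n !exprM lerXn2r ?nnegrE ?sqr_ge0//.
rewrite -real_normK ?num_real//; apply: lerXn2r => //; exact: ltW.
Qed.

End OperatorNorm.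

Set Implicit Arguments.
Unset Strict Implicit.

(** * Complex square-integrable random variables *)

Section ComplexMeasurable.
Context {R : realType} {d : measure_display} {T : measurableType d}.
Implicit Types f g : T -> R[i].

Definition cmeasurable f : Prop :=
  measurable_fun setT (fun x => complex.Re (f x)) /\
  measurable_fun setT (fun x => complex.Im (f x)).

Lemma cmeasurable_cst (a : R[i]) : cmeasurable (fun=> a).
Proof. by split; exact: measurable_cst. Qed.

Lemma cmeasurableD f g :
  cmeasurable f -> cmeasurable g -> cmeasurable (fun x => f x + g x).
Proof.
move=> [f1 f2] [g1 g2]; split.
  apply: eq_measurable_fun (measurable_funD f1 g1) => x _ /=.
  by case: (f x) (g x) => [? ?] [].
apply: eq_measurable_fun (measurable_funD f2 g2) => x _ /=.
by case: (f x) (g x) => [? ?] [].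
Qed.

Lemma cmeasurableM f g :
  cmeasurable f -> cmeasurable g -> cmeasurable (fun x => f x * g x).
Proof.
move=> [f1 f2] [g1 g2]; split.
  apply: eq_measurable_fun
    (measurable_funB (measurable_funM f1 g1) (measurable_funM f2 g2)) => x _ /=.
  by case: (f x) (g x) => [? ?] [].
apply: eq_measurable_fun
  (measurable_funD (measurable_funM f1 g2) (measurable_funM f2 g1)) => x _ /=.
by case: (f x) (g x) => [? ?] [].
Qed.

Lemma cmeasurable_normc2 f : cmeasurable f ->
  measurable_fun setT (fun x => Normc.normc (f x) ^+ 2).
Proof.
move=> [f1 f2]; apply: eq_measurable_fun
  (measurable_funD (measurable_funX 2 f1) (measurable_funX 2 f2)) => x _ /=.
by rewrite normc_sqr.
Qed.

Lemma cmeasurableV f : cmeasurable f -> cmeasurable (fun x => (f x)^-1).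
Proof.
move=> mf; have [f1 f2] := mf.
(* Inversion is the conjugate divided by the squared modulus. On nonnegative reals the inverse is
   the power [-1], also at 0, so the zeros of [f] need no separate case. *)
have mi : measurable_fun setT (fun x => (Normc.normc (f x) ^+ 2)^-1).
  have := measurableT_comp (@measurable_powR R (-1)) (cmeasurable_normc2 mf).
  apply: eq_measurable_fun => x _ /=.
  by rewrite powR_inv1// sqr_ge0.
split.
  apply: eq_measurable_fun (measurable_funM f1 mi) => x _ /=.
  by rewrite normc_sqr; case: (f x).
apply: eq_measurable_fun (measurable_funM (measurable_funN f2) mi) => x _ /=.
by rewrite normc_sqr; case: (f x) => a b /=; rewrite mulNr.
Qed.

Lemma cmeasurable_sum (I : Type) (r : seq I) (F : I -> T -> R[i]) :
  (forall i, cmeasurable (F i)) -> cmeasurable (fun x => \sum_(i <- r) F i x).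
Proof.
move=> mF; elim: r => [|i r IH].
  by under eq_fun do rewrite big_nil; exact: cmeasurable_cst.
by under eq_fun do rewrite big_cons; exact: cmeasurableD.
Qed.

Lemma cmeasurable_prod (I : Type) (r : seq I) (F : I -> T -> R[i]) :
  (forall i, cmeasurable (F i)) -> cmeasurable (fun x => \prod_(i <- r) F i x).
Proof.
move=> mF; elim: r => [|i r IH].
  by under eq_fun do rewrite big_nil; exact: cmeasurable_cst.
by under eq_fun do rewrite big_cons; exact: cmeasurableM.
Qed.

Lemma cmeasurable_det n (B : T -> 'M[R[i]]_n) :
  (forall i j, cmeasurable (fun x => B x i j)) ->
  cmeasurable (fun x => \det (B x)).
Proof.
move=> mB; apply: cmeasurable_sum => s; apply: cmeasurableM.
  exact: cmeasurable_cst.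
exact: cmeasurable_prod.
Qed.

(** Cramer's rule makes the trace a rational function of the entries, so measurability does not have
    to pass through the eigenvalues. *)
Lemma cmeasurable_tr_invmx n (B : T -> 'M[R[i]]_n) :
  (forall i j, cmeasurable (fun x => B x i j)) ->
  (forall x, B x \in unitmx) -> cmeasurable (fun x => \tr (invmx (B x))).
Proof.
move=> mB uB.
rewrite (_ : (fun x => _) = fun x => (\det (B x))^-1 * \sum_k cofactor (B x) k k).
  apply: cmeasurableM; first exact/cmeasurableV/cmeasurable_det.
  apply: cmeasurable_sum => k; apply: cmeasurableM; first exact: cmeasurable_cst.
  apply: cmeasurable_det => i j.
  by under eq_fun do rewrite !mxE; exact: mB.
apply/funext => x; rewrite /invmx uB mxtraceZ; congr (_ * _).
by apply: eq_bigr => k _; rewrite mxE.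
Qed.

End ComplexMeasurable.

Section LowerIntegral.
Context {R : realType} {d : measure_display} {T : measurableType d}.
Variable mu : {measure set T -> \bar R}.

(* Holds for nonmeasurable [g] too, since the integral of a nonnegative function
   is by definition a supremum over the simple functions below it. *)
Lemma ge0_le_lower_integral (f g : T -> \bar R) :
  (forall x, 0 <= f x)%E -> (forall x, f x <= g x)%E ->
  (\int[mu]_x f x <= \int[mu]_x g x)%E.
Proof.
move=> f0 fg; rewrite !ge0_integralTE//; last first.
  by move=> x; exact: le_trans (f0 x) (fg x).
apply: le_ereal_sup => _ [h /= hf <-]; exists h => // x.
exact: le_trans (hf x) (fg x).
Qed.

End LowerIntegral.

Section SquareIntegrable.
Context {R : realType} {d : measure_display} {T : measurableType d}.
Variable P : probability T R.
Implicit Types f g u v : T -> R[i].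

Definition L2 f : Prop :=
  cmeasurable f /\ P.-integrable setT (fun x => (Normc.normc (f x) ^+ 2)%:E).

Lemma integrable_le (f g : T -> R) : measurable_fun setT f ->
  (forall x, `|f x| <= g x) -> P.-integrable setT (EFin \o g) ->
  P.-integrable setT (EFin \o f).
Proof.
move=> mf fg; apply: le_integrable => //; first exact/measurable_EFinP.
by move=> x _; rewrite /= !lee_fin (le_trans (fg x))// ler_norm.
Qed.

Lemma cintegrable_le f (g : T -> R) : cmeasurable f ->
  (forall x, Normc.normc (f x) <= g x) -> P.-integrable setT (EFin \o g) ->
  cintegrable P f.
Proof.
move=> [f1 f2] fg ig; split; apply: (integrable_le _ _ ig) => // x.
  exact: le_trans (ler_normRe _) (fg x).
exact: le_trans (ler_normIm _) (fg x).
Qed.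

Lemma cintegrable_cmeasurable f : cintegrable P f -> cmeasurable f.
Proof.
by move=> [/measurable_int/measurable_EFinP ? /measurable_int/measurable_EFinP].
Qed.

Lemma integrable_cst (k : R) : P.-integrable setT (EFin \o cst k).
Proof. exact: finite_measure_integrable_cst. Qed.

Lemma integrableD_EFin (f g : T -> R) : P.-integrable setT (EFin \o f) ->
  P.-integrable setT (EFin \o g) ->
  P.-integrable setT (EFin \o (fun x => f x + g x)).
Proof. by move=> fi gi; exact: (integrableD _ fi gi). Qed.

Lemma integrableZl_EFin (k : R) (f : T -> R) : P.-integrable setT (EFin \o f) ->
  P.-integrable setT (EFin \o (fun x => k * f x)).
Proof. by move=> fi; exact: (integrableZl _ k fi). Qed.

Lemma L2_le f (g : T -> R) : cmeasurable f ->
  (forall x, Normc.normc (f x) ^+ 2 <= g x) ->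
  P.-integrable setT (EFin \o g) -> L2 f.
Proof.
move=> mf fg ig; split => //; apply: integrable_le ig.
  exact: cmeasurable_normc2.
by move=> x; rewrite ger0_norm ?sqr_ge0.
Qed.

Lemma L2_cst (a : R[i]) : L2 (fun=> a).
Proof.
by split; [exact: cmeasurable_cst|exact: integrable_cst].
Qed.

Lemma L2D f g : L2 f -> L2 g -> L2 (fun x => f x + g x).
Proof.
move=> [mf fi] [mg gi]; apply: (L2_le _ _ (integrableZl_EFin 2 (integrableD_EFin fi gi))).
  exact: cmeasurableD.
by move=> x; exact: normc_sqrD.
Qed.

Lemma L2Z a f : L2 f -> L2 (fun x => a * f x).
Proof.
move=> [mf fi]; apply: (L2_le _ _ (integrableZl_EFin (Normc.normc a ^+ 2) fi)).
  by apply: cmeasurableM => //; exact: cmeasurable_cst.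
by move=> x; rewrite Normc.normcM exprMn.
Qed.

Lemma L2N f : L2 f -> L2 (fun x => - f x).
Proof. by move=> /(L2Z (-1)); under eq_fun do rewrite mulN1r. Qed.

Lemma L2B f g : L2 f -> L2 g -> L2 (fun x => f x - g x).
Proof. by move=> lf /L2N; exact: L2D. Qed.

Lemma L2_sum n (F : 'I_n -> T -> R[i]) :
  (forall i, L2 (F i)) -> L2 (fun x => \sum_i F i x).
Proof.
move=> lF; rewrite (_ : (fun x => _) = fun x => \sum_(i <- index_enum 'I_n) F i x)//.
elim: (index_enum _) => [|i r IH].
  by under eq_fun do rewrite big_nil; exact: L2_cst.
by under eq_fun do rewrite big_cons; exact: L2D.
Qed.

Lemma L2M f g : L2 f -> L2 g -> cintegrable P (fun x => f x * g x).
Proof.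
move=> [mf fi] [mg gi]; apply: (cintegrable_le _ _ (integrableD_EFin fi gi)).
  exact: cmeasurableM.
move=> x; rewrite Normc.normcM.
have := sqr_ge0 (Normc.normc (f x) - Normc.normc (g x)).
by have := normc_ge0 (f x); have := normc_ge0 (g x); nra.
Qed.

Lemma L2_cintegrable f : L2 f -> cintegrable P f.
Proof.
by move=> lf; have := L2M lf (L2_cst 1); under eq_fun do rewrite mulr1.
Qed.

Lemma cexpectE f : cexpect P f =
  (\int[P]_x complex.Re (f x)) +i* (\int[P]_x complex.Im (f x)).
Proof. by rewrite /cexpect unlock. Qed.

Lemma cexpectD f g : cintegrable P f -> cintegrable P g ->
  cexpect P (fun x => f x + g x) = cexpect P f + cexpect P g.
Proof.
move=> [f1 f2] [g1 g2]; rewrite !cexpectE/=; apply/eqP; rewrite eq_complex /=.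
rewrite -!RintegralD//; apply/andP; split; apply/eqP; apply: eq_Rintegral => x _;
  by case: (f x) (g x) => [? ?] [].
Qed.

Lemma cexpectZ (a : R[i]) f : cintegrable P f ->
  cexpect P (fun x => a * f x) = a * cexpect P f.
Proof.
move=> [f1 f2]; rewrite !cexpectE; case: a => a b.
apply/eqP; rewrite eq_complex /=.
rewrite -!RintegralZl//.
rewrite -RintegralB//; [|exact: integrableZl_EFin|exact: integrableZl_EFin].
rewrite -RintegralD//; [|exact: integrableZl_EFin|exact: integrableZl_EFin].
by apply/andP; split; apply/eqP; apply: eq_Rintegral => x _; case: (f x).
Qed.

Lemma cexpect_cst (a : R[i]) : cexpect P (fun=> a) = a.
Proof.
rewrite cexpectE !Rintegral_cst//.
have PT : fine (P setT) = 1 by rewrite probability_setT.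
by rewrite !PT !mulr1; case: a.
Qed.

(** The factor 2 is the price of estimating real and imaginary parts separately; constants of this
    kind are harmless below. *)
Lemma normc_cexpect_le f (h : T -> R) : cintegrable P f ->
  P.-integrable setT (EFin \o h) -> (forall x, Normc.normc (f x) <= h x) ->
  Normc.normc (cexpect P f) <= 2 * \int[P]_x h x.
Proof.
move=> [f1 f2] hi fh; apply: le_trans (normc_le_ReIm _) _.
rewrite cexpectE /= mulr_natl mulr2n; apply: lerD.
  apply: le_trans (le_normr_Rintegral _ f1) _ => //.
  apply: le_Rintegral => //; first exact: integrable_norm.
  by move=> x _; exact: le_trans (ler_normRe _) (fh x).
apply: le_trans (le_normr_Rintegral _ f2) _ => //.
apply: le_Rintegral => //; first exact: integrable_norm.
by move=> x _; exact: le_trans (ler_normIm _) (fh x).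
Qed.

Definition msq f : R := \int[P]_x (Normc.normc (f x) ^+ 2).

Lemma msq_ge0 f : 0 <= msq f.
Proof. by apply: Rintegral_ge0 => x _; exact: sqr_ge0. Qed.

(** Nonnegativity of the variance of [h]. *)
Lemma sqr_Rintegral_le (h : T -> R) : P.-integrable setT (EFin \o h) ->
  P.-integrable setT (EFin \o (fun x => h x ^+ 2)) ->
  (\int[P]_x h x) ^+ 2 <= \int[P]_x (h x ^+ 2).
Proof.
move=> ih ih2; set m := \int[P]_x h x.
have : 0 <= \int[P]_x ((h x - m) ^+ 2) by apply: Rintegral_ge0 => x _; exact: sqr_ge0.
have -> : \int[P]_x ((h x - m) ^+ 2) =
    \int[P]_x (h x ^+ 2 + ((- 2 * m) * h x + m ^+ 2)).
  by apply: eq_Rintegral => x _; ring.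
have i1 := integrableZl_EFin (- 2 * m) ih.
have i2 := integrable_cst (m ^+ 2).
rewrite RintegralD//; last exact: integrableD_EFin.
rewrite RintegralD// RintegralZl// Rintegral_cst//.
have PT : fine (P setT) = 1 by rewrite probability_setT.
rewrite PT -/m; lra.
Qed.

Lemma normc_cexpect_sqr f : L2 f -> Normc.normc (cexpect P f) ^+ 2 <= msq f.
Proof.
move=> lf; have [mf fi] := lf; have [f1 f2] := L2_cintegrable lf.
have [m1 m2] := mf.
have h1 : P.-integrable setT (EFin \o (fun x => complex.Re (f x) ^+ 2)).
  apply: integrable_le fi; first exact: measurable_funX.
  by move=> x; rewrite ger0_norm ?sqr_ge0// normc_sqr lerDl sqr_ge0.
have h2 : P.-integrable setT (EFin \o (fun x => complex.Im (f x) ^+ 2)).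
  apply: integrable_le fi; first exact: measurable_funX.
  by move=> x; rewrite ger0_norm ?sqr_ge0// normc_sqr lerDr sqr_ge0.
have -> : msq f =
    \int[P]_x (complex.Re (f x) ^+ 2 + complex.Im (f x) ^+ 2).
  by apply: eq_Rintegral => x _; rewrite normc_sqr.
rewrite normc_sqr cexpectE /=.
by rewrite RintegralD// lerD// sqr_Rintegral_le.
Qed.

Lemma ccovC f g : ccov P f g = ccov P g f.
Proof. by rewrite /ccov mulrC; under eq_fun do rewrite mulrC. Qed.

Lemma ccovDl f g h : L2 f -> L2 g -> L2 h ->
  ccov P (fun x => f x + g x) h = ccov P f h + ccov P g h.
Proof.
move=> lf lg lh; rewrite /ccov; under eq_fun do rewrite mulrDl.
rewrite (cexpectD (L2M lf lh) (L2M lg lh)).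
rewrite (cexpectD (L2_cintegrable lf) (L2_cintegrable lg)); ring.
Qed.

Lemma ccovZl a f g : L2 f -> L2 g ->
  ccov P (fun x => a * f x) g = a * ccov P f g.
Proof.
move=> lf lg; rewrite /ccov; under eq_fun do rewrite -mulrA.
rewrite (cexpectZ a (L2M lf lg)) (cexpectZ a (L2_cintegrable lf)); ring.
Qed.

Lemma ccov_cstl a g : L2 g -> ccov P (fun=> a) g = 0.
Proof.
by move=> /L2_cintegrable lg; rewrite /ccov cexpectZ// cexpect_cst subrr.
Qed.

Lemma ccovDr f g h : L2 f -> L2 g -> L2 h ->
  ccov P h (fun x => f x + g x) = ccov P h f + ccov P h g.
Proof. by move=> lf lg lh; rewrite !(ccovC h) ccovDl. Qed.

Lemma ccov_suml n (F : 'I_n -> T -> R[i]) g : (forall i, L2 (F i)) -> L2 g ->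
  ccov P (fun x => \sum_i F i x) g = \sum_i ccov P (F i) g.
Proof.
move=> lF lg.
suff [] : L2 (fun x => \sum_(i <- index_enum 'I_n) F i x) /\
  ccov P (fun x => \sum_(i <- index_enum 'I_n) F i x) g =
  \sum_(i <- index_enum 'I_n) ccov P (F i) g by [].
elim: (index_enum _) => [|i r [lr IH]].
  under eq_fun do rewrite big_nil; rewrite big_nil ccov_cstl//.
  by split => //; exact: L2_cst.
under eq_fun do rewrite big_cons; rewrite big_cons ccovDl// IH.
by split => //; exact: L2D.
Qed.

Lemma msqD_le f g : L2 f -> L2 g ->
  msq (fun x => f x + g x) <= 2 * (msq f + msq g).
Proof.
move=> lf lg; have [[_ fi] [_ gi]] := (lf, lg).
rewrite /msq -RintegralD// -RintegralZl//; last exact: integrableD_EFin.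
apply: le_Rintegral => //.
- by have [] := L2D lf lg.
- exact/integrableZl_EFin/integrableD_EFin.
- by move=> x _; exact: normc_sqrD.
Qed.

(** Cauchy-Schwarz in additive form. Covariance ignores constants, so [a] and [b] may be any
    centres, which spares identifying the means. The weight [t] lets a small mean square of [f] be
    balanced against a merely bounded one of [g]. *)
Lemma ccov_le f g (a b : R[i]) (t : R) : 0 < t -> L2 f -> L2 g ->
  Normc.normc (ccov P f g) <=
  2 * (t * msq (fun x => f x - a) + t^-1 * msq (fun x => g x - b)).
Proof.
move=> t0 lf lg.
set u := fun x => f x - a; set v := fun x => g x - b.
have lu : L2 u by apply: L2B => //; exact: L2_cst.
have lv : L2 v by apply: L2B => //; exact: L2_cst.
have -> : ccov P f g = ccov P u v.
  have -> : f = (fun x => u x + a) by apply/funext => x; rewrite subrK.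
  have -> : g = (fun x => v x + b) by apply/funext => x; rewrite subrK.
  have lvb : L2 (fun x => v x + b) by apply: L2D => //; exact: L2_cst.
  rewrite (ccovDl lu (L2_cst a) lvb) (ccovDr lv (L2_cst b) lu).
  by rewrite (ccov_cstl a lvb) (ccovC u (fun=> b)) (ccov_cstl b lu) !addr0.
have amgm (p q : R) : 0 <= p -> 0 <= q -> p * q <= (t * p ^+ 2 + t^-1 * q ^+ 2) / 2.
  move=> p0 q0; have := sqr_ge0 (t * p - q).
  have ti0 : 0 < t^-1 by rewrite invr_gt0.
  move=> h; have := mulr_ge0 (ltW ti0) h.
  have -> : t^-1 * (t * p - q) ^+ 2 = t * p ^+ 2 + t^-1 * q ^+ 2 - 2 * (p * q).
    by field; rewrite gt_eqF.
  lra.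
have [[_ ui] [_ vi]] := (lu, lv).
have i1 := integrableZl_EFin t ui; have i2 := integrableZl_EFin t^-1 vi.
have h1 : Normc.normc (cexpect P (fun x => u x * v x)) <= t * msq u + t^-1 * msq v.
  have hi : P.-integrable setT (EFin \o (fun x => 2^-1 *
      (t * Normc.normc (u x) ^+ 2 + t^-1 * Normc.normc (v x) ^+ 2))).
    exact/integrableZl_EFin/integrableD_EFin.
  apply: le_trans (normc_cexpect_le (L2M lu lv) hi _) _.
    by move=> x; rewrite Normc.normcM mulrC mulrC [leRHS]mulrC amgm ?normc_ge0.
  rewrite RintegralZl//; last exact: integrableD_EFin.
  by rewrite mulrA divff// mul1r RintegralD// !RintegralZl.
have h2 : Normc.normc (cexpect P u * cexpect P v) <= t * msq u + t^-1 * msq v.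
  rewrite Normc.normcM; apply: le_trans (amgm _ _ (normc_ge0 _) (normc_ge0 _)) _.
  have e1 : t * Normc.normc (cexpect P u) ^+ 2 <= t * msq u.
    by apply: ler_wpM2l; [exact: ltW|exact: normc_cexpect_sqr].
  have e2 : t^-1 * Normc.normc (cexpect P v) ^+ 2 <= t^-1 * msq v.
    by apply: ler_wpM2l; [rewrite invr_ge0 ltW|exact: normc_cexpect_sqr].
  have := mulr_ge0 (ltW t0) (msq_ge0 u).
  have : 0 <= t^-1 * msq v by rewrite mulr_ge0 ?msq_ge0 ?invr_ge0 ?ltW.
  lra.
by apply: le_trans (ler_normcB _ _) _; lra.
Qed.

End SquareIntegrable.

(** * Linear extension of a differentiable function *)

Section Glue.
Context {R : realType}.
Implicit Types (f g h : R -> R) (a x l : R).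

Lemma is_deriveP f x l : is_derive x 1 f l <->
  t^-1 * (f (t + x) - f x) @[t --> 0^'] --> l.
Proof.
have E : (fun t : R => t^-1 *: ((f \o shift x) (t *: (1 : R)) - f x)) =
    (fun t => t^-1 * (f (t + x) - f x)).
  by apply/funext => t; rewrite /= scaler1.
split.
  by move=> [df <-]; rewrite /derive E; move: df; rewrite /derivable E.
by move=> fl; split; rewrite /derivable /derive E; [apply/cvg_ex; exists l|exact/cvg_lim].
Qed.

Lemma is_derive_continuous f x l : is_derive x 1 f l -> {for x, continuous f}.
Proof. by move=> [/derivable1_diffP/differentiable_continuous]. Qed.

(** Each difference quotient of [f] near [x] is one of [g] or of [h], and both families have limit
    [l]. This handles the endpoints [- M] and [M], where the extension changes its formula. *)
Lemma is_derive_glue f g h x l : is_derive x 1 g l -> is_derive x 1 h l ->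
  g x = f x -> h x = f x -> (\forall y \near x, f y = g y \/ f y = h y) ->
  is_derive x 1 f l.
Proof.
move=> /is_deriveP/cvgrPdist_lt gl /is_deriveP/cvgrPdist_lt hl gx hx fgh.
apply/is_deriveP/cvgrPdist_lt => e e0.
have near_fgh : \forall t \near 0^', f (t + x) = g (t + x) \/ f (t + x) = h (t + x).
  apply: nbhs_dnbhs.
  have c : (fun t : R => t + x) t @[t --> 0] --> x.
    by rewrite -[X in _ --> X]add0r; apply: cvgD; [exact: cvg_id|exact: cvg_cst].
  exact: (c _ fgh).
near=> t.
have [E|E] : f (t + x) = g (t + x) \/ f (t + x) = h (t + x) by near: t.
  by rewrite E -gx; near: t; exact: gl.
by rewrite E -hx; near: t; exact: hl.
Unshelve. all: by end_near. Qed.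

Definition clamp (M x : R) : R := Num.max (- M) (Num.min x M).

Lemma clamp_continuous M : continuous (clamp M).
Proof.
move=> x; apply: (@continuous_max _ _ (cst (- M)) (fun x => Num.min x M)).
  exact: cvg_cst.
apply: (@continuous_min _ _ id (cst M)); [exact: cvg_id|exact: cvg_cst].
Qed.

Lemma clamp_seg M x : 0 < M -> - M <= clamp M x <= M.
Proof.
move=> M0; rewrite /clamp le_max lexx /= ge_max ge_min lexx orbT andbT.
by rewrite lerNl (le_trans _ (ltW M0))// oppr_le0 ltW.
Qed.

Lemma clamp_id M x : - M <= x <= M -> clamp M x = x.
Proof. by move=> /andP[Mx xM]; rewrite /clamp min_l// max_r. Qed.

(** With [h'] the derivative of [h], this continues [h] beyond [-M, M] along its endpoint tangents.
    The derivative becomes [h'] composed with [clamp M], so its supremum over R is the one over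
    [-M, M]; a smooth cutoff would enlarge it. *)
Definition linext (M : R) h h' (x : R) : R :=
  h (clamp M x) + h' (clamp M x) * (x - clamp M x).

Lemma linext_id M h h' x : - M <= x <= M -> linext M h h' x = h x.
Proof. by move=> /clamp_id; rewrite /linext => ->; rewrite subrr mulr0 addr0. Qed.

Lemma is_derive_tangent (a b c x : R) :
  is_derive x 1 (fun y => a + b * (y - c)) b.
Proof.
have H := is_deriveD (is_derive_cst a x 1)
  (is_deriveZ b (is_deriveB (is_derive_id x (1 : R)) (is_derive_cst c x 1))).
by apply: (is_derive_eq H); rewrite subr0 add0r scaler1.
Qed.

Lemma is_derive_linext M h h' : 0 < M -> (forall x, is_derive x 1 h (h' x)) ->
  forall x, is_derive x 1 (linext M h h') (h' (clamp M x)).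
Proof.
move=> M0 dh x.
have NMM : - M <= M by rewrite (@le_trans _ _ 0)// ?oppr_le0 ltW.
pose L y := h (- M) + h' (- M) * (y - - M).
pose U y := h M + h' M * (y - M).
have clL y : y <= - M -> clamp M y = - M.
  by move=> yM; rewrite /clamp min_l ?(le_trans yM)// max_l.
have clU y : M <= y -> clamp M y = M.
  by move=> yM; rewrite /clamp min_r// max_r.
have EL y : y <= - M -> linext M h h' y = L y by move=> /clL; rewrite /linext /L => ->.
have EU y : M <= y -> linext M h h' y = U y by move=> /clU; rewrite /linext /U => ->.
have dL (y : R) : is_derive y 1 L (h' (- M)) by exact: is_derive_tangent.
have dU (y : R) : is_derive y 1 U (h' M) by exact: is_derive_tangent.
have [xM|xM|xM] := ltgtP x (- M).
- rewrite clL ?ltW//; apply: near_eq_is_derive (dL x).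
  near=> y; apply/esym/EL/ltW; near: y; exact: lt_nbhsl.
- have [xM'|xM'|->] := ltgtP x M.
  + rewrite clamp_id ?ltW ?ltW//; apply: near_eq_is_derive (dh x).
    near=> y; rewrite linext_id//; apply/andP; split; apply/ltW; near: y.
      exact: lt_nbhsr.
    exact: lt_nbhsl.
  + rewrite clU ?ltW//; apply: near_eq_is_derive (dU x).
    near=> y; apply/esym/EU/ltW; near: y; exact: lt_nbhsr.
  (* At an endpoint the function and its tangent share value and slope; elsewhere the extension is
     locally given by one formula. *)
  + rewrite clU//; apply: (is_derive_glue (dh M) (dU M)).
    * by rewrite linext_id ?lexx ?NMM.
    * by rewrite EU.
    near=> y; have [yM|/ltW yM] := leP y M; last by right; exact: EU.
    left; rewrite linext_id// yM andbT ltW//; near: y; apply: lt_nbhsr.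
    by rewrite (@lt_trans _ _ 0)// oppr_lt0.
- rewrite xM clL//; apply: (is_derive_glue (dL (- M)) (dh (- M))).
  + by rewrite EL.
  + by rewrite linext_id ?lexx ?NMM.
  near=> y; have [yM|/ltW yM] := leP y (- M); first by left; exact: EL.
  right; rewrite linext_id// yM /= ltW//; near: y; apply: lt_nbhsl.
  by rewrite (@lt_trans _ _ 0)// oppr_lt0.
Unshelve. all: by end_near. Qed.

End Glue.

Section ComplexDerivative.
Context {R : realType}.
Implicit Types f g : R -> R[i].

(** The derivative is carried as an explicit function, so that it can be computed through sums and
    products; [cderivE] then returns to [cderiv]. *)
Definition is_cderive f f' : Prop := forall x : R,
  is_derive x 1 (fun t => complex.Re (f t)) (complex.Re (f' x)) /\
  is_derive x 1 (fun t => complex.Im (f t)) (complex.Im (f' x)).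

Lemma is_cderive_cst (a : R[i]) : is_cderive (fun=> a) (fun=> 0).
Proof. by move=> x; split; exact: is_derive_cst. Qed.

Lemma is_cderive_id : is_cderive (fun x => x%:C) (fun=> 1).
Proof. by move=> x; split; [exact: is_derive_id|exact: is_derive_cst]. Qed.

Lemma is_cderiveD f g f' g' : is_cderive f f' -> is_cderive g g' ->
  is_cderive (fun x => f x + g x) (fun x => f' x + g' x).
Proof.
move=> df dg x; have [f1 f2] := df x; have [g1 g2] := dg x; split.
  rewrite (_ : (fun t => _) =
    (fun t => complex.Re (f t)) + (fun t => complex.Re (g t))).
    by apply: (is_derive_eq (is_deriveD f1 g1)); case: (f' x) (g' x) => [? ?] [].
  by apply/funext => t; rewrite !fctE; case: (f t) (g t) => [? ?] [].
rewrite (_ : (fun t => _) =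
  (fun t => complex.Im (f t)) + (fun t => complex.Im (g t))).
  by apply: (is_derive_eq (is_deriveD f2 g2)); case: (f' x) (g' x) => [? ?] [].
by apply/funext => t; rewrite !fctE; case: (f t) (g t) => [? ?] [].
Qed.

Lemma is_cderiveM f g f' g' : is_cderive f f' -> is_cderive g g' ->
  is_cderive (fun x => f x * g x) (fun x => f' x * g x + f x * g' x).
Proof.
move=> df dg x; have [f1 f2] := df x; have [g1 g2] := dg x; split.
  rewrite (_ : (fun t => _) =
    (fun t => complex.Re (f t)) * (fun t => complex.Re (g t)) -
    (fun t => complex.Im (f t)) * (fun t => complex.Im (g t))).
    apply: (is_derive_eq (is_deriveB (is_deriveM f1 g1) (is_deriveM f2 g2))).
    by case: (f' x) (g' x) (f x) (g x) => [? ?] [? ?] [? ?] [? ?] /=;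
      rewrite /GRing.scale /=; ring.
  by apply/funext => t; rewrite !fctE; case: (f t) (g t) => [? ?] [].
rewrite (_ : (fun t => _) =
  (fun t => complex.Re (f t)) * (fun t => complex.Im (g t)) +
  (fun t => complex.Im (f t)) * (fun t => complex.Re (g t))).
  apply: (is_derive_eq (is_deriveD (is_deriveM f1 g2) (is_deriveM f2 g1))).
  by case: (f' x) (g' x) (f x) (g x) => [? ?] [? ?] [? ?] [? ?] /=;
    rewrite /GRing.scale /=; ring.
by apply/funext => t; rewrite !fctE; case: (f t) (g t) => [? ?] [].
Qed.

Lemma is_cderive_eq f f' g' : is_cderive f f' -> (forall x, f' x = g' x) ->
  is_cderive f g'.
Proof. by move=> df E x; rewrite -E; exact: df. Qed.

Lemma is_cderiveN f f' : is_cderive f f' ->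
  is_cderive (fun x => - f x) (fun x => - f' x).
Proof.
move=> df; have := is_cderiveM (is_cderive_cst (-1)) df.
under eq_fun do rewrite mulN1r; move/is_cderive_eq; apply => x.
by rewrite mul0r add0r mulN1r.
Qed.

Lemma is_cderive_horner (p : {poly R[i]}) :
  is_cderive (fun x => p.[x%:C]) (fun x => p^`().[x%:C]).
Proof.
elim/poly_ind: p => [|p c IH].
  apply: (@is_cderive_eq _ (fun=> 0)); last by move=> x; rewrite deriv0 horner0.
  by under eq_fun do rewrite horner0; exact: is_cderive_cst.
have H := is_cderiveD (is_cderiveM IH is_cderive_id) (is_cderive_cst c).
rewrite (_ : (fun x => _) = fun x => p.[x%:C] * x%:C + c).
  apply: (is_cderive_eq H) => x.
  by rewrite derivD derivM derivX derivC !hornerE; ring.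
by apply/funext => x; rewrite !hornerE.
Qed.

Lemma is_cderive_resolvent (z : R[i]) : complex.Im z != 0 ->
  is_cderive (resolvent z) (fun x => resolvent z x ^+ 2).
Proof.
case: z => a b /= b0 x.
have b2 : 0 < b ^+ 2 by rewrite exprn_even_gt0.
have n0 t : (a - t) ^+ 2 + b ^+ 2 != 0 by rewrite gt_eqF// ltr_wpDl// sqr_ge0.
(* The squared modulus of [z - t]. It never vanishes, and real and imaginary parts of the resolvent
   are real fractions over it. *)
pose D (t : R) := (a - t) ^+ 2 + b ^+ 2.
have E t : resolvent (a +i* b) t = ((a - t) / D t) +i* (- (b / D t)).
  rewrite /resolvent div1r /D (_ : _ - _ = (a - t) +i* b)//.
  by apply/eqP; rewrite eq_complex /= subr0 !eqxx.
have dat : is_derive x 1 (fun t : R => a - t) (- 1).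
  have H := is_deriveB (is_derive_cst a x (1 : R)) (is_derive_id x (1 : R)).
  by apply: (is_derive_eq H); rewrite sub0r.
have dD : is_derive x 1 D (- 2 * (a - x)).
  have H := is_deriveD (is_deriveM dat dat) (is_derive_cst (b ^+ 2) x (1 : R)).
  by apply: (is_derive_eq H); rewrite /GRing.scale /=; ring.
have dDV : is_derive x 1 (fun t => (D t)^-1) (2 * (a - x) / D x ^+ 2).
  have H := @is_deriveV _ D x _ 1 (n0 x) dD.
  by apply: (is_derive_eq H); rewrite /GRing.scale /= -exprVn; field; exact: n0.
rewrite E; split.
  under eq_fun do rewrite E /=.
  apply: (is_derive_eq (is_deriveM dat dDV)).
  by rewrite /GRing.scale /=; rewrite /D; field; exact: n0.
under eq_fun do rewrite E /=.
have H := is_deriveM (is_derive_cst (- b) x (1 : R)) dDV.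
under eq_fun do rewrite -mulNr.
apply: (is_derive_eq H).
by rewrite /GRing.scale /=; rewrite /D; field; exact: n0.
Qed.

Lemma normc_resolvent_le (z : R[i]) (x : R) : complex.Im z != 0 ->
  Normc.normc (resolvent z x) <= `|complex.Im z|^-1.
Proof.
move=> z0; have b0 : 0 < `|complex.Im z| by rewrite normr_gt0.
have zx := normc_subC_ge z x.
by rewrite /resolvent div1r Normc.normcV lef_pV2 ?posrE// (lt_le_trans b0).
Qed.

Lemma normc_resolvent_sqr_le (z : R[i]) (x : R) : complex.Im z != 0 ->
  Normc.normc (resolvent z x ^+ 2) <= `|complex.Im z| ^- 2.
Proof.
move=> z0; rewrite normcX -exprVn; apply: lerXn2r (normc_resolvent_le x z0).
  by rewrite nnegrE normc_ge0.
by rewrite nnegrE invr_ge0.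
Qed.

Lemma cderivE f f' : is_cderive f f' -> cderiv f = f'.
Proof.
move=> df; apply/funext => x; rewrite /cderiv !derive1E.
by have [[_ ->] [_ ->]] := df x; case: (f' x).
Qed.

Lemma is_cderive_C1 f f' : is_cderive f f' ->
  continuous (fun x => complex.Re (f' x)) ->
  continuous (fun x => complex.Im (f' x)) -> C1 f.
Proof.
move=> df c1 c2; split.
- by move=> x; have [[]] := df x.
- by move=> x; have [_ []] := df x.
- rewrite (_ : derive1 _ = fun x => complex.Re (f' x))//.
  by apply/funext => x; rewrite derive1E; have [[_ ->]] := df x.
- rewrite (_ : derive1 _ = fun x => complex.Im (f' x))//.
  by apply/funext => x; rewrite derive1E; have [_ [_ ->]] := df x.
Qed.

Lemma is_cderive2_C1 f f' f'' : is_cderive f f' -> is_cderive f' f'' -> C1 f.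
Proof.
by move=> df df'; apply: (is_cderive_C1 df) => x; have [d1 d2] := df' x;
  [exact: is_derive_continuous d1|exact: is_derive_continuous d2].
Qed.

Lemma C1_horner (p : {poly R[i]}) : C1 (fun x => p.[x%:C]).
Proof. exact: is_cderive2_C1 (is_cderive_horner _) (is_cderive_horner _). Qed.

Lemma C1_resolvent (z : R[i]) : complex.Im z != 0 -> C1 (resolvent z).
Proof.
move=> z0; have dz := is_cderive_resolvent z0; apply: (is_cderive2_C1 dz).
exact: (is_cderiveM dz dz).
Qed.

Lemma C1_resolventB_horner (z : R[i]) (p : {poly R[i]}) : complex.Im z != 0 ->
  C1 (fun x => resolvent z x - p.[x%:C]).
Proof.
move=> z0; have dz := is_cderive_resolvent z0.
apply: is_cderive2_C1.
  exact: is_cderiveD dz (is_cderiveN (is_cderive_horner p)).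
exact: is_cderiveD (is_cderiveM dz dz) (is_cderiveN (is_cderive_horner _)).
Qed.

Definition clinext (M : R) f f' (x : R) : R[i] :=
  linext M (fun t => complex.Re (f t)) (fun t => complex.Re (f' t)) x +i*
  linext M (fun t => complex.Im (f t)) (fun t => complex.Im (f' t)) x.

Lemma clinext_id M f f' x : - M <= x <= M -> clinext M f f' x = f x.
Proof. by move=> Mx; rewrite /clinext !linext_id//; case: (f x). Qed.

Lemma is_cderive_clinext M f f' : 0 < M -> is_cderive f f' ->
  is_cderive (clinext M f f') (fun x => f' (clamp M x)).
Proof.
by move=> M0 df x; split;
  apply: (is_derive_linext (h' := fun t => _ (f' t))) => // t; have [] := df t.
Qed.

Lemma C1_clinext M f f' f'' : 0 < M -> is_cderive f f' -> is_cderive f' f'' ->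
  C1 (clinext M f f').
Proof.
move=> M0 df df'; apply: (is_cderive_C1 (is_cderive_clinext M0 df)) => x.
  apply: (@continuous_comp _ _ _ (clamp M) (fun t => complex.Re (f' t))).
    exact: clamp_continuous.
  by have [d1 _] := df' (clamp M x); exact: is_derive_continuous d1.
apply: (@continuous_comp _ _ _ (clamp M) (fun t => complex.Im (f' t))).
  exact: clamp_continuous.
by have [_ d2] := df' (clamp M x); exact: is_derive_continuous d2.
Qed.

Lemma supnorm_le (A : set R) f (B : R) :
  (forall x, A x -> Normc.normc (f x) <= B) -> (supnorm A f <= B%:E)%E.
Proof. by move=> fB; apply: ge_ereal_sup => _ [x Ax <-]; rewrite lee_fin fB. Qed.

Lemma supnorm_ge0 (A : set R) f (x : R) : A x -> (0 <= supnorm A f)%E.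
Proof.
move=> Ax; apply: (@le_trans _ _ (Normc.normc (f x))%:E).
  by rewrite lee_fin normc_ge0.
by apply: ereal_sup_ubound; exists x.
Qed.

End ComplexDerivative.

(** * Polynomial approximation of the resolvent *)

Section ResolventApproximation.
Context {R : realType}.

Lemma bernoulli_ineq (e : R) n : 0 <= e -> n%:R * e <= (1 + e) ^+ n.
Proof.
move=> e0; suff : 1 + n%:R * e <= (1 + e) ^+ n by lra.
elim: n => [|n IH]; first by rewrite mul0r addr0 expr0.
rewrite exprS -natr1; apply: (@le_trans _ _ ((1 + e) * (1 + n%:R * e))).
  by have := mulr_ge0 (ler0n R n) (sqr_ge0 e); nra.
by rewrite ler_wpM2l// addr_ge0.
Qed.

(** Split [q ^+ n] into two factors [p ^+ n] with [p] the square root of [q]. By Bernoulli's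
    inequality for [p^-1 - 1], one factor absorbs the linear growth; the other still tends to
    zero. *)
Lemma cvg_arith_geometric (q e : R) : 0 <= q -> q < 1 -> 0 < e ->
  exists n, n.+2%:R * q ^+ n <= e.
Proof.
move=> q0 q1 e0; pose p := Num.sqrt q.
have p0 : 0 <= p by exact: sqrtr_ge0.
have pq : p ^+ 2 = q by rewrite sqr_sqrtr.
have p1 : p < 1 by rewrite -(@expr_lt1 _ 2)// pq.
have np n : n%:R * p ^+ n <= (1 - p)^-1.
  have [->|pn0] := eqVneq p 0.
    case: n => [|n]; first by rewrite mul0r subr0 invr1.
    by rewrite expr0n /= mulr0 subr0 invr1.
  have pp : 0 < p by rewrite lt_def pn0.
  have h := @bernoulli_ineq (p^-1 - 1) n.
  have -> : n%:R * p ^+ n = (1 - p)^-1 * ((n%:R * (p^-1 - 1)) * p ^+ n * p).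
    by field; rewrite pn0 /= subr_eq0 eq_sym lt_eqF.
  rewrite ler_piMr ?invr_ge0 ?subr_ge0 ?(ltW p1)//.
  apply: (@le_trans _ _ (p^-1 ^+ n * p ^+ n * p)).
    rewrite ler_wpM2r// ler_wpM2r ?exprn_ge0//.
    have := h; rewrite (addrC _ (- 1)) addrA subrr add0r; apply.
    by rewrite addrC subr_ge0 invf_ge1// ltW.
  by rewrite -exprMn mulVf// expr1n mul1r ltW.
pose C := (1 - p)^-1 + 2.
have C0 : 0 < C by rewrite ltr_wpDl// invr_ge0 subr_ge0 ltW.
have /cvgrPdist_lt/(_ (e / C)) : (fun n => p ^+ n) @ \oo --> (0 : R).
  by apply: cvg_expr; rewrite ger0_norm.
rewrite divr_gt0// => /(_ isT)[n _ /(_ n (leqnn n))] /=.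
rewrite sub0r normrN ger0_norm ?exprn_ge0// ltr_pdivlMr// => pn.
exists n; apply: le_trans (ltW pn); rewrite -pq -exprM mulnC exprM expr2.
rewrite mulrA mulrC ler_wpM2l ?exprn_ge0//.
rewrite -addn2 natrD mulrDl; apply: lerD => //.
by rewrite ler_piMr// exprn_ile1// ltW.
Qed.

(* [r_z] is expanded in a geometric series around the point
   [c = - i M^2 / Im z], far enough from the real axis on the other side of
   [z] for the disc of convergence around [c] to contain [[- M, M]]. *)
Lemma resolvent_approx (M e : R) (z : R[i]) :
  0 < M -> 0 < e -> complex.Im z != 0 ->
  exists p : {poly R[i]}, forall x, - M <= x <= M ->
    Normc.normc (resolvent z x ^+ 2 - p^`().[x%:C]) <= e.
Proof.
case: z => a b /= M0 e0 b0.
have b2 : 0 < b ^+ 2 by rewrite exprn_even_gt0.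
have M2 : 0 < M ^+ 2 by rewrite exprn_gt0.
pose z : R[i] := a +i* b.
pose t := M ^+ 2 / b.
pose c : R[i] := 0 +i* (- t).
pose s := z - c.
have t2 : t ^+ 2 = M ^+ 2 * M ^+ 2 / b ^+ 2 by rewrite /t expr_div_n -expr2.
have bt : b * t = M ^+ 2 by rewrite /t mulrC divfK.
(* Here [s] has imaginary part [b + t] and [b * t = M ^+ 2], whence the cross term [2 * M ^+ 2].
   Points of [-M, M] have squared distance at most [M ^+ 2 + t ^+ 2] from [c], so the ratio [q] of
   the series is below 1. *)
have s2 : b ^+ 2 + 2 * M ^+ 2 + t ^+ 2 <= Normc.normc s ^+ 2.
  rewrite normc_sqr /= opprK.
  by have := sqr_ge0 (a - 0); rewrite -bt; nra.
have s0 : 0 < Normc.normc s.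
  rewrite lt_neqAle normc_ge0 andbT; apply/eqP => E.
  by move: s2; rewrite -E expr0n /= t2; have := sqr_ge0 t; rewrite t2; nra.
have sn0 : s != 0.
  by apply/eqP => E; move: s0; rewrite E Normc.normc0 ltxx.
have bs : `|b| <= Normc.normc s.
  rewrite -(@ler_pXn2r _ 2)// ?nnegrE ?normc_ge0// real_normK ?num_real//.
  by apply: le_trans s2; have := sqr_ge0 t; nra.
pose U := M ^+ 2 + t ^+ 2.
have U0 : 0 <= U by rewrite addr_ge0 ?sqr_ge0.
pose q := Num.sqrt U / Normc.normc s.
have q0 : 0 <= q by rewrite divr_ge0 ?sqrtr_ge0 ?normc_ge0.
have q1 : q < 1.
  rewrite /q ltr_pdivrMr// mul1r -(@ltr_pXn2r _ 2)// ?nnegrE ?sqrtr_ge0 ?normc_ge0//.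
  by rewrite sqr_sqrtr//; apply: lt_le_trans s2; rewrite /U; nra.
(* The two error terms below are at most [q ^+ n / b ^+ 2] and [n.+1%:R * q ^+ n / b ^+ 2]; together
   they give the factor [n.+2%:R]. *)
have [n nq] := cvg_arith_geometric q0 q1 (mulr_gt0 e0 b2).
pose W : {poly R[i]} := s^-1 *: ('X - c%:P).
(* Since [z - x] is [s * (1 - W)], this is the truncated geometric series of the resolvent. *)
pose P : {poly R[i]} := s^-1 *: \sum_(k < n.+1) W ^+ k.
have PE : P * (z%:P - 'X) = 1 - W ^+ n.+1.
  have -> : z%:P - 'X = s *: (1 - W).
    rewrite scalerBr scalerA divff// scale1r /s alg_polyC polyCB; ring.
  rewrite -scalerAr -scalerAl scalerA divff// scale1r mulrC.
  by rewrite -[RHS]opprB subrX1 -mulNr opprB.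
(* Differentiating the polynomial identity [PE] gives the exact error of the derivative, so no
   infinite series has to be differentiated term by term. *)
have dPE : P^`() * (z%:P - 'X) - P = - (W ^+ n.+1)^`().
  have := congr1 (@deriv _) PE.
  by rewrite derivM !derivB derivC derivX sub0r mulrN1 (derivC 1) sub0r.
exists P => x Mx.
have b0' : complex.Im z != 0 by [].
have zx0 := subC_neq0 z x b0'.
have rE : resolvent z x = (z - x%:C)^-1 by rewrite /resolvent div1r.
have rb : Normc.normc (resolvent z x) <= `|b|^-1.
  exact: (normc_resolvent_le (z := z)).
have Wq : Normc.normc W.[x%:C] <= q.
  rewrite /W !hornerE Normc.normcM Normc.normcV mulrC ler_pM2r ?invr_gt0//.
  rewrite -(@ler_pXn2r _ 2)// ?nnegrE ?normc_ge0 ?sqrtr_ge0// [leRHS]sqr_sqrtr//.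
  rewrite normc_sqr /= opprK add0r subr0 lerD2r.
  by move: Mx => /andP[]; nra.
have hE : (W ^+ n.+1).[x%:C] = W.[x%:C] ^+ n.+1 by rewrite horner_exp.
have dE : (W ^+ n.+1)^`().[x%:C] = n.+1%:R * s^-1 * W.[x%:C] ^+ n.
  rewrite deriv_exp /= hornerMn hornerM horner_exp derivZ derivB derivX derivC.
  by rewrite subr0 !hornerE; ring.
have key : resolvent z x ^+ 2 - P^`().[x%:C] =
    resolvent z x ^+ 2 * W.[x%:C] ^+ n.+1 +
    resolvent z x * (n.+1%:R * s^-1 * W.[x%:C] ^+ n).
  have E1 : (z%:P - 'X).[x%:C] = z - x%:C by rewrite !hornerE.
  have E2 (V : {poly R[i]}) : (1 - V).[x%:C] = 1 - V.[x%:C] by rewrite !hornerE.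
  have h1 : P.[x%:C] * (z - x%:C) = 1 - W.[x%:C] ^+ n.+1.
    by rewrite -E1 -hornerM PE E2 hE.
  have h2 : P^`().[x%:C] * (z - x%:C) - P.[x%:C] =
      - (n.+1%:R * s^-1 * W.[x%:C] ^+ n).
    by rewrite -dE -E1 -hornerM -!hornerN -hornerD dPE.
  rewrite rE; move: h1 h2 zx0.
  move: (P^`().[_]) (P.[_]) (n.+1%:R * _ * _) (W.[_] ^+ n.+1) (z - x%:C).
  move=> P' p Q' Q y h1 h2 y0.
  apply: (mulIf (expf_neq0 2 y0)).
  have -> : (y^-1 ^+ 2 - P') * y ^+ 2 = 1 - p * y - (P' * y - p) * y by field.
  rewrite h1 h2; by field.
have nn : Normc.normc (n.+1%:R : R[i]) = n.+1%:R.
  by rewrite -(rmorph_nat (real_complex R)) normc_real ger0_norm.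
rewrite key; move: (resolvent z x) rb => y rb.
apply: le_trans (ler_normcD _ _) _.
rewrite !Normc.normcM !normcX Normc.normcV nn.
have bi0 : 0 <= `|b|^-1 by rewrite invr_ge0.
have si : (Normc.normc s)^-1 <= `|b|^-1.
  by rewrite lef_pV2 ?posrE// normr_gt0.
set w := Normc.normc W.[x%:C] in Wq *; set r := Normc.normc y in rb *.
have w0 : 0 <= w by exact: normc_ge0.
have r0 : 0 <= r by exact: normc_ge0.
have wn : w ^+ n <= q ^+ n by apply: lerXn2r.
have wn1 : w ^+ n.+1 <= q ^+ n.
  rewrite exprS; apply: le_trans wn; rewrite ler_piMl ?exprn_ge0//.
  exact: le_trans Wq (ltW q1).
have t1 : r ^+ 2 * w ^+ n.+1 <= `|b|^-1 ^+ 2 * q ^+ n.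
  by apply: ler_pM; rewrite ?exprn_ge0//; apply: lerXn2r.
have t3 : r * (n.+1%:R * (Normc.normc s)^-1 * w ^+ n) <=
    `|b|^-1 * (n.+1%:R * `|b|^-1 * q ^+ n).
  apply: ler_pM => //; first by rewrite !mulr_ge0 ?invr_ge0 ?normc_ge0 ?exprn_ge0.
  apply: ler_pM; rewrite ?exprn_ge0 ?mulr_ge0 ?invr_ge0 ?normc_ge0//.
  exact: ler_wpM2l.
apply: (le_trans (lerD t1 t3)).
have -> : `|b|^-1 ^+ 2 * q ^+ n + `|b|^-1 * (n.+1%:R * `|b|^-1 * q ^+ n) =
    (`|b| ^+ 2)^-1 * (n.+2%:R * q ^+ n).
  by rewrite -exprVn -[n.+2%:R]natr1; ring.
rewrite real_normK ?num_real// mulrC ler_pdivrMr//.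
Qed.

End ResolventApproximation.

(** * The asymptotic covariance map on polynomials *)

Section AsymptoticCovariance.
Context {R : realType} {M K : R} {alpha : nat -> nat -> R[i]}.
Context {rho : segfun M -> segfun M -> R[i]}.
Hypothesis M_gt0 : 0 < M.
Hypothesis K_ge0 : 0 <= K.
Hypothesis rho_cov : asymptotic_covariance K alpha rho.

Let evalp (p : {poly R[i]}) (x : R) : R[i] := p.[x%:C].

Let C1seg_restr f : C1 f -> C1seg (restr M f).
Proof. by move=> cf; exists f. Qed.

Lemma rho_linl (a : R[i]) f g h : C1 f -> C1 g -> C1 h ->
  rho (restr M (fun x => a * f x + g x)) (restr M h) =
  a * rho (restr M f) (restr M h) + rho (restr M g) (restr M h).
Proof.
move=> cf cg ch; have [lin _ _ _] := rho_cov.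
by have [] := lin a _ _ _ (C1seg_restr cf) (C1seg_restr cg) (C1seg_restr ch).
Qed.

Lemma rho_linr (a : R[i]) f g h : C1 f -> C1 g -> C1 h ->
  rho (restr M h) (restr M (fun x => a * f x + g x)) =
  a * rho (restr M h) (restr M f) + rho (restr M h) (restr M g).
Proof.
move=> cf cg ch; have [lin _ _ _] := rho_cov.
by have [] := lin a _ _ _ (C1seg_restr cf) (C1seg_restr cg) (C1seg_restr ch).
Qed.

Lemma rho_le f g (F G : R) : C1 f -> C1 g -> 0 <= F ->
  (forall x, - M <= x <= M -> Normc.normc (cderiv f x) <= F) ->
  (forall x, - M <= x <= M -> Normc.normc (cderiv g x) <= G) ->
  Normc.normc (rho (restr M f) (restr M g)) <= K * F * G.
Proof.
move=> cf cg F0 fF gG; have [_ _ _ bd] := rho_cov.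
have s0 : seg M 0 by rewrite /seg /= in_itv /= oppr_le0 ltW.
rewrite -lee_fin; apply: le_trans (bd _ _ cf cg) _.
rewrite !EFinM; apply: lee_pmul.
- by rewrite mule_ge0// ?lee_fin// (supnorm_ge0 _ s0).
- exact: supnorm_ge0 s0.
- rewrite lee_pmul ?lee_fin// ?(supnorm_ge0 _ s0)//.
  by apply: supnorm_le => x; rewrite /seg /= in_itv /=; exact: fF.
- by apply: supnorm_le => x; rewrite /seg /= in_itv /=; exact: gG.
Qed.

Let C1_monomial k : C1 (@monomial R k).
Proof.
have := C1_horner ('X^k : {poly R[i]}).
rewrite (_ : (fun x => _) = monomial k)//; apply/funext => x.
by rewrite hornerXn /monomial rmorphXn.
Qed.

(** Brings in the exponent 0, where the monomial is the constant 1 and [rho] vanishes, so that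
    constant coefficients need no special treatment. *)
Lemma rho_monomial m n : alpha m 0 = 0 -> alpha 0 n = 0 ->
  rho (restr M (monomial m)) (restr M (monomial n)) = alpha m n.
Proof.
have [_ mon one _] := rho_cov; have c1 k := C1seg_restr (@C1_monomial k).
have E : restr M (@monomial R 0) = (fun=> 1) by [].
case: m n => [|m] [|n] m0 n0; rewrite ?E; last exact: mon.
- by rewrite m0 (one _ (c1 0)).1.
- by rewrite n0 (one _ (c1 n.+1)).1.
- by rewrite m0 (one _ (c1 m.+1)).2.
Qed.

Hypothesis alphal0 : forall m, alpha m 0 = 0.
Hypothesis alpha0r : forall n, alpha 0 n = 0.

(** Induction on the number of coefficients kept peels off one monomial at a time from a fixed
    polynomial. *)
Let trunc (p : {poly R[i]}) k : {poly R[i]} := \sum_(i < k) p`_i *: 'X^i.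

Let truncS p k : evalp (trunc p k.+1) =
  (fun x => p`_k * monomial k x + evalp (trunc p k) x).
Proof.
apply/funext => x; rewrite /evalp /trunc big_ord_recr /= hornerD addrC.
by rewrite hornerZ hornerXn /monomial rmorphXn.
Qed.

Let trunc0 p : evalp (trunc p 0) = (fun=> 0).
Proof. by apply/funext => x; rewrite /evalp /trunc big_ord0 horner0. Qed.

Let trunc_size p : trunc p (size p) = p.
Proof. by rewrite /trunc -poly_def coefK. Qed.

Let rho0l h : C1 h -> rho (restr M (fun=> 0)) (restr M h) = 0.
Proof.
move=> ch; have c0 : C1 (fun=> 0 : R[i]) by rewrite -(trunc0 0); exact: C1_horner.
have := rho_linl 1 c0 c0 ch.
rewrite (_ : (fun x => _) = (fun=> 0)); last by apply/funext => x; rewrite mul1r addr0.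
by rewrite mul1r => /esym/(canRL (addrK _)); rewrite subrr.
Qed.

Let rho0r h : C1 h -> rho (restr M h) (restr M (fun=> 0)) = 0.
Proof.
move=> ch; have c0 : C1 (fun=> 0 : R[i]) by rewrite -(trunc0 0); exact: C1_horner.
have := rho_linr 1 c0 c0 ch.
rewrite (_ : (fun x => _) = (fun=> 0)); last by apply/funext => x; rewrite mul1r addr0.
by rewrite mul1r => /esym/(canRL (addrK _)); rewrite subrr.
Qed.

Lemma rho_horner (p q : {poly R[i]}) :
  rho (restr M (fun x => p.[x%:C])) (restr M (fun x => q.[x%:C])) =
  \sum_(i < size p) \sum_(j < size q) p`_i * (q`_j * alpha i j).
Proof.
have inner m k : rho (restr M (monomial m)) (restr M (evalp (trunc q k))) =
    \sum_(j < k) q`_j * alpha m j.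
  elim: k => [|k IH]; first by rewrite trunc0 big_ord0 rho0r.
  rewrite truncS rho_linr//; last exact: C1_horner.
  by rewrite IH big_ord_recr /= addrC rho_monomial.
suff E k : rho (restr M (evalp (trunc p k))) (restr M (evalp q)) =
    \sum_(i < k) \sum_(j < size q) p`_i * (q`_j * alpha i j).
  by have := E (size p); rewrite trunc_size.
elim: k => [|k IH]; first by rewrite trunc0 big_ord0 rho0l//; exact: C1_horner.
rewrite truncS rho_linl//; [|exact: C1_horner|exact: C1_horner].
by rewrite IH big_ord_recr /= addrC -{1}(trunc_size q) inner mulr_sumr.
Qed.

(** The arguments are replaced one after the other: the error is [rho] at [(r_z - p, r_w)] plus
    [rho] at [(p, r_w - q)]. In the second term [p'] is within [e] of the derivative of [r_z], which
    accounts for the last summand [e]. *)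
Lemma rho_approx (z w : R[i]) (p q : {poly R[i]}) (e : R) :
  complex.Im z != 0 -> complex.Im w != 0 -> 0 <= e ->
  (forall x, - M <= x <= M ->
    Normc.normc (resolvent z x ^+ 2 - p^`().[x%:C]) <= e) ->
  (forall x, - M <= x <= M ->
    Normc.normc (resolvent w x ^+ 2 - q^`().[x%:C]) <= e) ->
  Normc.normc (rho (restr M (resolvent z)) (restr M (resolvent w)) -
    \sum_(i < size p) \sum_(j < size q) p`_i * (q`_j * alpha i j)) <=
  K * e * (`|complex.Im w| ^- 2 + `|complex.Im z| ^- 2 + e).
Proof.
move=> z0 w0 e0 pe qe; rewrite -rho_horner.
have cz := C1_resolvent z0; have cw := C1_resolvent w0.
have cp := C1_horner p; have cq := C1_horner q.
have dz := is_cderive_resolvent z0; have dw := is_cderive_resolvent w0.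
have dzp := is_cderiveD dz (is_cderiveN (is_cderive_horner p)).
have dwq := is_cderiveD dw (is_cderiveN (is_cderive_horner q)).
have czp := C1_resolventB_horner p z0; have cwq := C1_resolventB_horner q w0.
have -> : rho (restr M (resolvent z)) (restr M (resolvent w)) =
    rho (restr M (fun x => resolvent z x - p.[x%:C])) (restr M (resolvent w)) +
    rho (restr M (fun x => p.[x%:C])) (restr M (fun x => resolvent w x - q.[x%:C])) +
    rho (restr M (fun x => p.[x%:C])) (restr M (fun x => q.[x%:C])).
  have := rho_linl 1 czp cp cw; rewrite mul1r.
  rewrite (_ : (fun x => 1 * _ + _) = resolvent z); last first.
    by apply/funext => x; rewrite mul1r subrK.
  move=> ->; rewrite -addrA; congr (_ + _).
  have := rho_linr 1 cwq cq cp; rewrite mul1r.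
  rewrite (_ : (fun x => 1 * _ + _) = resolvent w)//.
  by apply/funext => x; rewrite mul1r subrK.
rewrite addrK; apply: le_trans (ler_normcD _ _) _.
rewrite -addrA mulrDr; apply: lerD.
  apply: rho_le => //.
    by move=> x Mx; rewrite (cderivE dzp) pe.
  by move=> x Mx; rewrite (cderivE dw) normc_resolvent_sqr_le.
rewrite -[X in _ <= X]mulrA [e * _]mulrC mulrA.
apply: rho_le => //.
- by rewrite addr_ge0// exprn_ge0// ?invr_ge0.
- move=> x Mx; rewrite (cderivE (is_cderive_horner p)).
  rewrite -[X in Normc.normc X](subKr (resolvent z x ^+ 2)).
  by apply: le_trans (ler_normcB _ _) _; rewrite lerD ?pe ?normc_resolvent_sqr_le.
- by move=> x Mx; rewrite (cderivE dwq) qe.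
Qed.

End AsymptoticCovariance.

(** * Traces of powers and resolvents at fixed size *)

Section RestrictedMeanSquare.
Context {R : realType} {d : measure_display} {T : measurableType d}.
Variable P : probability T R.
Implicit Types (f g : T -> R[i]) (A : set T).

Definition msq_on A f : R := \int[P]_(x in A) (Normc.normc (f x) ^+ 2).

Lemma integrable_on A (h : T -> R) : measurable A ->
  P.-integrable setT (EFin \o h) -> P.-integrable A (EFin \o h).
Proof. by move=> mA; exact: integrableS. Qed.

Lemma msq_split A f : measurable A -> L2 P f ->
  msq P f = msq_on A f + msq_on (~` A) f.
Proof.
move=> mA [_ fi]; have mAC := measurableC mA.
rewrite /msq /msq_on -Rintegral_setU ?setUv//.
by apply/disj_setPS => x [].
Qed.

Lemma msq_onC_le A f : measurable A -> L2 P f -> msq_on (~` A) f <= msq P f.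
Proof.
move=> mA lf; rewrite (msq_split mA lf) lerDr.
by apply: Rintegral_ge0 => x _; exact: sqr_ge0.
Qed.

Lemma msq_onD_le A f g : measurable A -> L2 P f -> L2 P g ->
  msq_on A (fun x => f x + g x) <= 2 * (msq_on A f + msq_on A g).
Proof.
move=> mA lf lg; have [[_ fi] [_ gi]] := (lf, lg).
have [_ fgi] := L2D lf lg.
have fA := integrable_on mA fi; have gA := integrable_on mA gi.
have sA := integrable_on mA (integrableD_EFin fi gi).
rewrite /msq_on -RintegralD// -RintegralZl//.
apply: le_Rintegral => //; first exact: integrable_on.
  exact/(integrable_on mA)/integrableZl_EFin/integrableD_EFin.
by move=> x _; exact: normc_sqrD.
Qed.

Lemma msq_onZ A (a : R[i]) f : measurable A -> L2 P f ->
  msq_on A (fun x => a * f x) = Normc.normc a ^+ 2 * msq_on A f.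
Proof.
move=> mA [_ fi]; rewrite /msq_on -RintegralZl//; last exact: integrable_on.
by apply: eq_Rintegral => x _; rewrite Normc.normcM exprMn.
Qed.

Lemma msq_on_cst A (a : R[i]) : measurable A ->
  msq_on A (fun=> a) = Normc.normc a ^+ 2 * fine (P A).
Proof. by move=> mA; rewrite /msq_on Rintegral_cst. Qed.

Lemma msq_on_le A f (h : T -> R) : measurable A -> L2 P f ->
  P.-integrable setT (EFin \o h) ->
  (forall x, Normc.normc (f x) ^+ 2 <= h x) ->
  msq_on A f <= \int[P]_(x in A) h x.
Proof. by move=> mA [_ fi] hi fh; apply: le_Rintegral => //; exact: integrable_on. Qed.

Lemma fine_probabilityC A : measurable A -> fine (P (~` A)) = 1 - fine (P A).
Proof.
move=> mA; rewrite probability_setC// fineB//; exact: fin_num_measure.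
Qed.

(** Passes from concentration around [c] off [A] to concentration everywhere. Off [A], which carries
    at least half the mass, [c] is [f] minus a small quantity; this bounds [|c|^2] by [4 * (v + B)].
    On [A] the crude bound by [f] and [c] separately suffices. *)
Lemma msq_sub_const A f (c : R[i]) (v B E p : R) :
  measurable A -> L2 P f -> fine (P A) <= p -> p <= 2^-1 ->
  msq_on (~` A) (fun x => f x - c) <= v -> msq P f <= B -> msq_on A f <= E ->
  msq P (fun x => f x - c) <= v + 2 * (E + 4 * (v + B) * p).
Proof.
move=> mA lf Ap p2 fcv fB fE.
have lc : L2 P (fun=> c) by exact: L2_cst.
have lNc : L2 P (fun=> - c) by exact: L2_cst.
have lfc : L2 P (fun x => f x - c) by exact: L2B.
have mAC := measurableC mA.
have P0 : 0 <= fine (P A) by exact: fine_ge0.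
have c2 : Normc.normc c ^+ 2 <= 4 * (v + B).
  have : msq_on (~` A) (fun x => f x + -1 * (f x - c)) <=
      2 * (msq_on (~` A) f + msq_on (~` A) (fun x => -1 * (f x - c))).
    by apply: msq_onD_le => //; exact: L2Z.
  rewrite (_ : (fun x => f x + _) = fun=> c); last first.
    by apply/funext => x; rewrite mulN1r opprB addrC subrK.
  rewrite msq_on_cst// msq_onZ// normcN Normc.normc1 expr1n mul1r fine_probabilityC//.
  have := msq_onC_le mA lf; have := sqr_ge0 (Normc.normc c); nra.
rewrite (msq_split mA lfc) addrC; apply: lerD => //.
apply: le_trans (msq_onD_le mA lf lNc) _.
rewrite ler_pM2l// lerD// msq_on_cst// normcN.
by apply: ler_pM => //; exact: sqr_ge0.
Qed.

End RestrictedMeanSquare.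

(** Cauchy-Schwarz against the constant vector, from [(h i - h j) ^+ 2 >= 0] summed over all
    pairs. *)
Lemma sqr_sum_le (R : realDomainType) N (h : 'I_N -> R) :
  (\sum_i h i) ^+ 2 <= N%:R * \sum_i h i ^+ 2.
Proof.
have E : \sum_i \sum_j (h i ^+ 2 + h j ^+ 2) = 2 * (N%:R * \sum_i h i ^+ 2).
  under eq_bigr do rewrite big_split /= sumr_const card_ord.
  by rewrite big_split /= sumr_const card_ord sumrMnl -mulr_natl; ring.
rewrite -(@ler_pM2l _ 2)// -E expr2 big_distrlr /= mulr_sumr.
apply: ler_sum => i _; rewrite mulr_sumr; apply: ler_sum => j _.
by have := sqr_ge0 (h i - h j); nra.
Qed.

Section Ensemble.
Context {R : realType} {d : measure_display} {T : measurableType d}.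
Context {P : probability T R} {N : nat} {X : T -> 'M[R[i]]_N}.
Hypothesis mX : measurable_mx X.
Hypothesis hX : forall x, X x \is hermsymmx.
Hypothesis iX : forall n, cintegrable P (fun x => \tr (X x ^+ n)).
Hypothesis iXX : forall m n,
  cintegrable P (fun x => \tr (X x ^+ m) * \tr (X x ^+ n)).

Let trX k x := \tr (X x ^+ k).

Lemma L2_tr_exp k : L2 P (fun x => \tr (X x ^+ k)).
Proof.
split; first exact: cintegrable_cmeasurable (iX k).
have [i1 _] := iXX k k; apply: eq_integrable i1 => // x _.
by rewrite mxtrace_exp// normc_sqr /= mulr0 subr0 expr0n /= addr0.
Qed.

Lemma normc2_tr_exp k x : Normc.normc (\tr (X x ^+ k)) ^+ 2 =
  complex.Re (\tr (X x ^+ k)) ^+ 2.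
Proof. by rewrite mxtrace_exp// normc_sqr /= expr0n /= addr0. Qed.

(** The trace is real, so [ccov], which takes no conjugate, is its variance. *)
Lemma msq_tr_exp k : msq P (trX k) =
  complex.Re (ccov P (trX k) (trX k)) + Normc.normc (cexpect P (trX k)) ^+ 2.
Proof.
have im0 : complex.Im (cexpect P (trX k)) = 0.
  rewrite cexpectE /= (@eq_Rintegral _ _ _ _ _ (cst 0)) ?Rintegral_cst ?mul0r//.
  by move=> x _; rewrite /trX mxtrace_exp.
have -> : msq P (trX k) = complex.Re (cexpect P (fun x => trX k x * trX k x)).
  rewrite cexpectE /=; apply: eq_Rintegral => x _.
  by rewrite /trX mxtrace_exp// normc_sqr /= mulr0 subr0 expr0n /= addr0.
rewrite /ccov normc_sqr; move: (cexpect P (trX k)) im0 => [a b] /= ->.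
ring.
Qed.

(** Reduces fourth moments of the trace of one power to second moments of the trace of another,
    which the hypotheses control. *)
Lemma sqr_tr_exp_le k x : complex.Re (\tr (X x ^+ k)) ^+ 2 <=
  N%:R * complex.Re (\tr (X x ^+ k.*2)).
Proof.
rewrite !mxtrace_exp//=; set l := eigval (X x).
have -> : \sum_i l i ^+ k.*2 = \sum_i (l i ^+ k) ^+ 2.
  by apply: eq_bigr => i _; rewrite -exprM muln2.
exact: sqr_sum_le (fun i => l i ^+ k).
Qed.

(** Integrates [y <= e * y ^+ 2 + e^-1] over [A], where [y] is the squared trace. The free parameter
    [e] replaces the optimisation in Cauchy-Schwarz. *)
Lemma msq_on_tr_exp_le A k (e : R) : 0 < e -> measurable A ->
  msq_on P A (trX k) <=
  e * N%:R ^+ 2 * msq P (trX k.*2) + e^-1 * fine (P A).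
Proof.
move=> e0 mA; have lk := L2_tr_exp k; have [_ i2] := L2_tr_exp k.*2.
pose h x := e * N%:R ^+ 2 * Normc.normc (\tr (X x ^+ k.*2)) ^+ 2 + e^-1.
have ih1 := integrableZl_EFin (e * N%:R ^+ 2) i2.
have ih2 : P.-integrable setT (EFin \o (fun=> e^-1)) by exact: integrable_cst.
have ih : P.-integrable setT (EFin \o h) by exact: integrableD_EFin.
apply: (@le_trans _ _ (\int[P]_(x in A) h x)).
  apply: msq_on_le => // x; rewrite /h !normc2_tr_exp.
  have := sqr_tr_exp_le k x; have := sqr_ge0 (complex.Re (\tr (X x ^+ k))).
  move: (complex.Re (\tr (X x ^+ k)) ^+ 2) (complex.Re (\tr (X x ^+ k.*2))) => y s y0 ys.
  have ei : 0 < e^-1 by rewrite invr_gt0.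
  have ee : e * e^-1 = 1 by rewrite divff// gt_eqF.
  have y2 : y ^+ 2 <= N%:R ^+ 2 * s ^+ 2.
    by rewrite -exprMn; apply: lerXn2r => //; exact: le_trans ys.
  have : y <= e * y ^+ 2 + e^-1.
    rewrite -(@ler_pM2l _ e)// mulrDr ee.
    by have := sqr_ge0 (e * y - 1); nra.
  by move=> /le_trans; apply; rewrite lerD2r -mulrA ler_pM2l.
rewrite RintegralD//; [|exact: integrable_on|exact: integrable_on].
rewrite Rintegral_cst// lerD2r RintegralZl//; last exact: integrable_on.
apply: ler_wpM2l; first by rewrite mulr_ge0 ?sqr_ge0 // ltW.
have -> : msq P (trX k.*2) = msq_on P A (trX k.*2) + msq_on P (~` A) (trX k.*2).
  exact: msq_split mA (L2_tr_exp _).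
rewrite lerDl.
by apply: Rintegral_ge0 => x _; exact: sqr_ge0.
Qed.

Lemma measurable_opnorm_gt (M : R) : 0 < M ->
  measurable [set x | M < opnorm (X x)].
Proof.
move=> M0.
rewrite (_ : [set _ | _] = \bigcup_m
    [set x | N%:R * M ^+ m.*2 < complex.Re (\tr (X x ^+ m.*2))]); last first.
  apply/seteqP; split => x /=.
    by move=> /(opnorm_gtE (hX x) M M0)[m]; exists m.
  by move=> [m _ ?]; apply/(opnorm_gtE (hX x) M M0); exists m.
apply: bigcupT_measurable => m.
have [[mf _] _] := L2_tr_exp m.*2.
have := mf measurableT _ (measurable_itv `](N%:R * M ^+ m.*2), +oo[).
by rewrite setTI preimage_itvoy.
Qed.

Section Resolvent.
Variable z : R[i].
Hypothesis z_nonreal : complex.Im z != 0.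

Let Y x := \tr (invmx (z%:M - X x)).

Lemma cmeasurable_tr_resolvent : cmeasurable Y.
Proof.
apply: cmeasurable_tr_invmx => [i j|x]; last exact: subscal_unit.
apply: (@eq_ind_r _ _ cmeasurable (cmeasurableD (cmeasurable_cst (z%:M i j))
  (cmeasurableM (cmeasurable_cst (-1)) (mX i j)))).
by apply/funext => x; rewrite !mxE mulN1r.
Qed.

Lemma normc_tr_resolvent x : Normc.normc (Y x) <= N%:R * `|complex.Im z|^-1.
Proof.
rewrite /Y mxtrace_resolvent// /trace_fun; apply: le_trans (ler_normc_sum _ _ _ _) _.
rewrite -[N in N%:R]card_ord mulr_natl -sumr_const; apply: ler_sum => k _.
exact: normc_resolvent_le.
Qed.

Lemma normc2_tr_resolvent x :
  Normc.normc (Y x) ^+ 2 <= N%:R ^+ 2 * `|complex.Im z| ^- 2.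
Proof.
by rewrite -exprVn -exprMn; apply: lerXn2r (normc_tr_resolvent x);
  rewrite nnegrE ?normc_ge0// mulr_ge0.
Qed.

Lemma L2_tr_resolvent : L2 P Y.
Proof.
apply: (L2_le cmeasurable_tr_resolvent normc2_tr_resolvent).
exact: integrable_cst.
Qed.

Lemma msq_on_tr_resolvent_le A : measurable A ->
  msq_on P A Y <= N%:R ^+ 2 * `|complex.Im z| ^- 2 * fine (P A).
Proof.
move=> mA; rewrite -Rintegral_cst//.
apply: (msq_on_le (h := fun=> _)) => //; first exact: L2_tr_resolvent.
  exact: integrable_cst.
exact: normc2_tr_resolvent.
Qed.

(** The variance bound is applied to the tangent extension [g] of [f], the resolvent minus [p]. Off
    the event all eigenvalues lie in [-M, M], where [g] and [f] agree. *)
Lemma msq_on_resolventB_le (M K e : R) (p : {poly R[i]}) :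
  0 < M -> 0 <= K -> 0 <= e ->
  (forall f : R -> R[i], C1 f -> (cvar P (fun x => trace_fun f (X x)) <=
    K%:E * supnorm setT (cderiv f) ^+ 2)%E) ->
  (forall x, - M <= x <= M ->
    Normc.normc (resolvent z x ^+ 2 - p^`().[x%:C]) <= e) ->
  exists c, msq_on P (~` [set x | M < opnorm (X x)])
    (fun x => (Y x - \sum_(i < size p) p`_i * trX i x) - c) <= K * e ^+ 2.
Proof.
move=> M0 K0 e0 var pe; set A := [set x | _].
have mA : measurable A by exact: measurable_opnorm_gt.
pose f x := resolvent z x - p.[x%:C].
pose f' x := resolvent z x ^+ 2 - p^`().[x%:C].
have dz := is_cderive_resolvent z_nonreal.
have df : is_cderive f f' := is_cderiveD dz (is_cderiveN (is_cderive_horner p)).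
have df' := is_cderiveD (is_cderiveM dz dz) (is_cderiveN (is_cderive_horner p^`())).
pose g := clinext M f f'.
have dg : is_cderive g (fun x => f' (clamp M x)) := is_cderive_clinext M0 df.
have cg : C1 g := C1_clinext M0 df df'.
exists (cexpect P (fun x => trace_fun g (X x))); set c := cexpect _ _.
set D := fun x => _ - c.
have lD : L2 P D.
  apply: L2B; last exact: L2_cst.
  apply: L2B; first exact: L2_tr_resolvent.
  by apply: L2_sum => i; apply: L2Z; exact: L2_tr_exp.
have DE x : (~` A) x -> D x = trace_fun g (X x) - c.
  move=> /negP; rewrite -leNgt => /(opnorm_leP (hX x) M (ltW M0)) XM.
  rewrite /D /Y mxtrace_resolvent//; congr (_ - _).
  have -> : \sum_(i < size p) p`_i * trX i x = trace_fun (fun y => p.[y%:C]) (X x).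
    rewrite /trX; under eq_bigr do rewrite mxtrace_exp// rmorph_sum mulr_sumr.
    rewrite exchange_big /=; apply: eq_bigr => k _.
    by rewrite horner_coef; apply: eq_bigr => i _; rewrite rmorphXn.
  rewrite -sumrB; apply: eq_bigr => k _.
  by rewrite /g clinext_id// -ler_norml XM.
have supg : (supnorm setT (cderiv g) <= e%:E)%E.
  apply: supnorm_le => x _; rewrite (cderivE dg); apply: pe.
  exact: clamp_seg.
have varg : (cvar P (fun x => trace_fun g (X x)) <= (K * e ^+ 2)%:E)%E.
  apply: le_trans (var g cg) _; rewrite EFinM lee_pmul ?lee_fin//.
    by rewrite expe2 mule_ge0// (supnorm_ge0 _ (x := 0)).
  by rewrite expe2 expr2 EFinM lee_pmul// (supnorm_ge0 _ (x := 0)).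
have [_ iD] := lD.
have iDA := integrable_on (measurableC mA) iD.
rewrite -lee_fin; apply: le_trans varg.
have fin : (\int[P]_(x in ~` A) (Normc.normc (D x) ^+ 2)%:E)%E \is a fin_num.
  by apply: integrable_fin_num => //; exact: measurableC.
rewrite /msq_on /Rintegral fineK//.
(* The variance integrand is not shown to be measurable. It dominates pointwise the squared
   difference extended by zero on the event, which is enough for lower integrals. *)
rewrite /cvar unlock integral_mkcond; apply: ge0_le_lower_integral => x.
  by rewrite patchE; case: ifP => // _; rewrite lee_fin sqr_ge0.
rewrite patchE; case: ifPn => [|_]; last by rewrite lee_fin sqr_ge0.
by rewrite inE => /DE <-.
Qed.

End Resolvent.
End Ensemble.

(** * Limits in the size of the matrix *)

Section ComplexLimit.
Context {R : realType}.
Implicit Types (u : nat -> R[i]) (l : R[i]).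

(** Radii of balls in [R[i]^o] are complex numbers; a positive one has zero imaginary part, so real
    radii suffice. *)
Lemma cvg_normcP u l : (u : nat -> R[i]^o) @ \oo --> (l : R[i]^o) <->
  forall e : R, 0 < e -> \forall N \near \oo, Normc.normc (l - u N) < e.
Proof.
split=> [/cvgrPdist_lt ul e e0|ul].
  have eC : 0 < e%:C :> R[i] by rewrite ltcR.
  by apply: filterS (ul _ eC) => N; rewrite normr_normc ltcR.
apply/cvgrPdist_lt => -[a b]; rewrite ltcE /= => /andP[/eqP b0 a0].
by apply: filterS (ul a a0) => N; rewrite normr_normc b0 ltcR.
Qed.

Lemma cvg_normc_bounded u l : (u : nat -> R[i]^o) @ \oo --> (l : R[i]^o) ->
  exists2 C, 0 <= C & \forall N \near \oo, Normc.normc (u N) <= C.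
Proof.
move=> /cvg_normcP/(_ 1 ltr01) ul; exists (Normc.normc l + 1).
  by rewrite addr_ge0 ?normc_ge0.
apply: filterS ul => N /ltW lu.
rewrite -[u N](subKr l); apply: le_trans (ler_normcB _ _) _.
by rewrite lerD2l.
Qed.

Lemma near_expVn_le (k : nat) (e : R) : 0 < e ->
  \forall N \near \oo, (N%:R ^- k.+1 : R) <= e.
Proof.
move=> e0; exists (Num.truncn e^-1).+1 => // N /= lN.
have N0 : 0 < N%:R :> R by rewrite ltr0n (leq_trans _ lN).
have eN : e^-1 <= N%:R by apply: le_trans (ltW (truncnS_gt _)) _; rewrite ler_nat.
have N1 : 1 <= N%:R :> R by rewrite ler1n (leq_trans _ lN).
rewrite -[e]invrK lef_pV2 ?posrE ?exprn_gt0 ?invr_gt0//.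
by apply: le_trans eN _; rewrite exprS ler_peMr ?(ltW N0)// exprn_ege1.
Qed.

End ComplexLimit.

Section Asymptotics.
Context {R : realType} {d : nat -> measure_display}.
Context {T : forall N : nat, measurableType (d N)}.
Context {P : forall N : nat, probability (T N) R}.
Context {X : forall N : nat, T N -> 'M[R[i]]_N}.
Arguments X : clear implicits.
Context {M K : R} {alpha1 : nat -> R[i]} {alpha2 : nat -> nat -> R[i]}.
Hypothesis M_gt0 : 0 < M.
Hypothesis K_gt0 : 0 < K.
Hypothesis X_ensemble : self_adjoint_ensemble P X.
Hypothesis moment_cvg : forall n : nat,
  (fun N : nat => N%:R^-1 * cexpect (P N) (fun w => \tr (X N w ^+ n)) : R[i]^o)
    @ \oo --> (alpha1 n : R[i]^o).
Hypothesis cov_cvg : forall m n : nat,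
  (fun N : nat =>
     ccov (P N) (fun w => \tr (X N w ^+ m)) (fun w => \tr (X N w ^+ n)) : R[i]^o)
    @ \oo --> (alpha2 m n : R[i]^o).
Hypothesis tail : (fun N : nat =>
     ((N%:R ^+ 8)%:E * P N [set w | (M < opnorm (X N w))%R])%E)
    @ \oo --> (0%E : \bar R).
Hypothesis var_bound : forall (f : R -> R[i]) (N : nat), C1 f ->
  (cvar (P N) (fun w => trace_fun f (X N w)) <=
     K%:E * supnorm setT (cderiv f) ^+ 2)%E.

Let mX N : measurable_mx (X N). Proof. by have [] := X_ensemble. Qed.
Let hX N w : X N w \is hermsymmx. Proof. by have [] := X_ensemble. Qed.
Let iX N n : cintegrable (P N) (fun w => \tr (X N w ^+ n)).
Proof. by have [] := X_ensemble. Qed.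
Let iXX N m n :
  cintegrable (P N) (fun w => \tr (X N w ^+ m) * \tr (X N w ^+ n)).
Proof. by have [] := X_ensemble. Qed.

Let A N : set (T N) := [set w | M < opnorm (X N w)].
Arguments A : clear implicits.
Let mA N : measurable (A N). Proof. exact: measurable_opnorm_gt. Qed.

Let L2X N k : L2 (P N) (fun w => \tr (X N w ^+ k)).
Proof. exact: L2_tr_exp. Qed.

Lemma tail_probability_le : \forall N \near \oo, fine (P N (A N)) <= N%:R ^- 8.
Proof.
have [_ ft] := (fine_cvgP _ _).1 tail.
have /cvgrPdist_lt/(_ 1 ltr01) := ft.
apply: filterS2 (nbhs_infty_gt 0) => N N0 /=.
rewrite sub0r normrN fineM ?fin_num_measure//= => /(le_lt_trans (ler_norm _)) /ltW h.
have N0' : 0 < N%:R ^+ 8 :> R by rewrite exprn_gt0// ltr0n.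
by rewrite -[leRHS]div1r ler_pdivlMr// mulrC.
Qed.

(* The traces of powers and resolvents of [X N] all satisfy this: the mean
   square is [O(N^2)], and the part of it carried by the event [||X N|| > M]
   is [O(N^-2)]. *)
Definition tame (F : forall N, T N -> R[i]) : Prop :=
  [/\ forall N, L2 (P N) (F N),
      exists2 C, 0 <= C & \forall N \near \oo, msq (P N) (F N) <= C * N%:R ^+ 2 &
      exists2 C, 0 <= C &
        \forall N \near \oo, msq_on (P N) (A N) (F N) <= C * N%:R ^- 2].

Lemma tameD F G : tame F -> tame G -> tame (fun N x => F N x + G N x).
Proof.
move=> [lF [C1 C10 F1] [C2 C20 F2]] [lG [D1 D10 G1] [D2 D20 G2]]; split.
- by move=> N; exact: L2D.
- exists (2 * (C1 + D1)); first by rewrite mulr_ge0 ?addr_ge0.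
  apply: filterS2 F1 G1 => N f1 g1; apply: le_trans (msqD_le (lF N) (lG N)) _.
  by rewrite -mulrA ler_pM2l// mulrDl lerD.
- exists (2 * (C2 + D2)); first by rewrite mulr_ge0 ?addr_ge0.
  apply: filterS2 F2 G2 => N f1 g1; apply: le_trans (msq_onD_le (mA N) (lF N) (lG N)) _.
  by rewrite -mulrA ler_pM2l// mulrDl lerD.
Qed.

Lemma tameZ a F : tame F -> tame (fun N x => a * F N x).
Proof.
move=> [lF [C1 C10 F1] [C2 C20 F2]]; split.
- by move=> N; exact: L2Z.
- exists (Normc.normc a ^+ 2 * C1); first by rewrite mulr_ge0 ?sqr_ge0.
  apply: filterS F1 => N f1; rewrite [leLHS](msq_onZ a measurableT (lF N)) -[leRHS]mulrA.
  by rewrite ler_wpM2l ?sqr_ge0.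
- exists (Normc.normc a ^+ 2 * C2); first by rewrite mulr_ge0 ?sqr_ge0.
  by apply: filterS F2 => N f1; rewrite msq_onZ// -[leRHS]mulrA ler_wpM2l ?sqr_ge0.
Qed.

Lemma tame0 : tame (fun N x => 0).
Proof.
have E N B : measurable B -> msq_on (P N) B (fun=> 0) = 0.
  by move=> mB; rewrite msq_on_cst// Normc.normc0 expr0n mul0r.
split.
- by move=> N; exact: L2_cst.
- by exists 0 => //; apply: nearW => N; rewrite [leLHS](E N setT)// mul0r.
- by exists 0 => //; apply: nearW => N; rewrite E// mul0r.
Qed.

Lemma tame_sum n (F : 'I_n -> forall N, T N -> R[i]) :
  (forall i, tame (F i)) -> tame (fun N x => \sum_i F i N x).
Proof.
move=> tF.
rewrite (_ : (fun N x => _) =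
  fun N x => \sum_(i <- index_enum 'I_n) F i N x)//.
elim: (index_enum _) => [|i r IH].
  rewrite (_ : (fun N x => _) = fun N x => 0); first exact: tame0.
  by apply/functional_extensionality_dep => N; apply/funext => x; rewrite big_nil.
rewrite (_ : (fun N x => _) = fun N x => F i N x + \sum_(j <- r) F j N x).
  exact: tameD.
by apply/functional_extensionality_dep => N; apply/funext => x; rewrite big_cons.
Qed.

(** Variance plus squared mean: the variance converges, and the mean is [N] times a convergent
    sequence. *)
Lemma msq_tr_exp_bounded k : exists2 C, 0 <= C &
  \forall N \near \oo, msq (P N) (fun w => \tr (X N w ^+ k)) <= C * N%:R ^+ 2.
Proof.
have [C C0 c1] := cvg_normc_bounded (@cov_cvg k k).
have [B B0 c2] := cvg_normc_bounded (@moment_cvg k).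
exists (C + B ^+ 2); first by rewrite addr_ge0 ?sqr_ge0.
apply: filterS3 (nbhs_infty_gt 0) c1 c2 => N N0 h1 h2.
have N1 : 1 <= N%:R :> R by rewrite ler1n.
have N00 : 0 < N%:R :> R by rewrite ltr0n.
rewrite [leLHS](msq_tr_exp (@hX N) k) mulrDl; apply: lerD.
  apply: le_trans (ler_norm _) _; apply: le_trans (ler_normRe _) _.
  by apply: le_trans h1 _; rewrite ler_peMr// exprn_ege1.
rewrite -exprMn; apply: lerXn2r; rewrite ?nnegrE ?normc_ge0 ?mulr_ge0//.
move: h2; rewrite Normc.normcM Normc.normcV -(rmorph_nat (real_complex R)) normc_real.
by rewrite ger0_norm// mulrC ler_pdivrMr.
Qed.

Lemma tame_tr_exp k : tame (fun N w => \tr (X N w ^+ k)).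
Proof.
split; first by move=> N; exact: L2X.
  exact: msq_tr_exp_bounded.
have [C C0 h] := msq_tr_exp_bounded k.*2.
exists (C + 1); first by rewrite addr_ge0.
apply: filterS3 (nbhs_infty_gt 0) h tail_probability_le => N N0 h1 h2.
have N00 : 0 < N%:R :> R by rewrite ltr0n.
(* The weight [N ^- 6] balances the two terms: [N ^- 6 * N ^+ 2 * N ^+ 2] and [N ^+ 6 * N ^- 8] are
   both [N ^- 2]. This is where the exponent 8 of the tail hypothesis is spent. *)
have e0 : 0 < N%:R ^- 6 :> R by rewrite invr_gt0 exprn_gt0.
apply: le_trans (msq_on_tr_exp_le (@hX N) (iX N) (iXX N) k e0 (mA N)) _.
rewrite mulrDl mul1r; apply: lerD.
  apply: (@le_trans _ _ (N%:R ^- 6 * N%:R ^+ 2 * (C * N%:R ^+ 2))).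
    by rewrite ler_wpM2l// mulr_ge0 ?sqr_ge0 ?ltW.
  by rewrite le_eqVlt; apply/orP; left; apply/eqP; field; rewrite gt_eqF.
apply: (@le_trans _ _ ((N%:R ^- 6)^-1 * N%:R ^- 8)).
  by rewrite ler_wpM2l// invr_ge0 ltW.
by rewrite le_eqVlt; apply/orP; left; apply/eqP; field; rewrite gt_eqF.
Qed.

Lemma tame_tr_resolvent z : complex.Im z != 0 ->
  tame (fun N w => \tr (invmx (z%:M - X N w))).
Proof.
move=> z0; have lY N := L2_tr_resolvent (P := P N) (@mX N) (@hX N) z0.
have b0 : 0 <= `|complex.Im z| ^- 2 by rewrite invr_ge0 exprn_ge0.
split => //.
  exists (`|complex.Im z| ^- 2) => //; apply: nearW => N.
  apply: le_trans (msq_on_tr_resolvent_le (@mX N) (@hX N) z0 measurableT) _.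
  by rewrite probability_setT /= mulr1 mulrC.
exists (`|complex.Im z| ^- 2) => //.
apply: filterS2 (nbhs_infty_gt 0) tail_probability_le => N N0 h.
have N00 : 0 < N%:R :> R by rewrite ltr0n.
have N1 : 1 <= N%:R :> R by rewrite ler1n.
apply: le_trans (msq_on_tr_resolvent_le (@mX N) (@hX N) z0 (mA N)) _.
rewrite mulrAC mulrC ler_wpM2l//.
apply: (@le_trans _ _ (N%:R ^+ 2 * N%:R ^- 8)); first by rewrite ler_wpM2l ?sqr_ge0.
have -> : N%:R ^+ 2 * N%:R ^- 8 = N%:R ^- 6 :> R by field; rewrite gt_eqF.
by rewrite lef_pV2 ?posrE ?exprn_gt0// ler_weXn2l.
Qed.

Let Y z N w := \tr (invmx (z%:M - X N w)).
Let S (p : {poly R[i]}) N w := \sum_(i < size p) p`_i * \tr (X N w ^+ i).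
Arguments Y : clear implicits.
Arguments S : clear implicits.

Lemma tame_tr_poly (p : {poly R[i]}) : tame (S p).
Proof. by apply: tame_sum => i; apply: tameZ; exact: tame_tr_exp. Qed.

Lemma msq_resolventB_le z (p : {poly R[i]}) (e : R) :
  complex.Im z != 0 -> 0 < e ->
  (forall x, - M <= x <= M ->
    Normc.normc (resolvent z x ^+ 2 - p^`().[x%:C]) <= e) ->
  \forall N \near \oo,
    exists c, msq (P N) (fun w => (Y z N w - S p N w) - c) <= 2 * K * e ^+ 2.
Proof.
move=> z0 e0 pe.
have [lD [B B0 hB] [E E0 hE]] : tame (fun N w => Y z N w + -1 * S p N w).
  by apply: tameD; [exact: tame_tr_resolvent|apply: tameZ; exact: tame_tr_poly].
have Ke : 0 < K * e ^+ 2 by rewrite mulr_gt0// exprn_gt0.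
(* Collects the contributions of the event from [msq_sub_const], all of order [N ^- 2]. Once
   [C * N ^- 2] is below [K * e ^+ 2], the total is [2 * K * e ^+ 2]. *)
pose C := 2 * (E + 4 * (K * e ^+ 2 + B)).
have C0 : 0 < C by rewrite /C mulr_gt0// ltr_wpDl// mulr_gt0// ltr_pwDl.
have CK : 0 < K * e ^+ 2 / C by rewrite divr_gt0.
have hN := near_expVn_le 1 CK.
have hN8 := @near_expVn_le R 7 2^-1 ltac:(by rewrite invr_gt0).
near=> N.
have N0 : (0 < N)%N by near: N; exact: nbhs_infty_gt.
have N00 : 0 < N%:R :> R by rewrite ltr0n.
have N1 : 1 <= N%:R :> R by rewrite ler1n.
have [c hc] := msq_on_resolventB_le (P := P N) (@mX N) (@hX N) (iX N) (iXX N) z0 M_gt0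
  (ltW K_gt0) (ltW e0) (fun f => @var_bound f N) pe.
exists c.
have DE : (fun w => (Y z N w - S p N w) - c) =
    (fun w => (Y z N w + -1 * S p N w) - c).
  by apply/funext => w; rewrite mulN1r.
rewrite DE in hc *.
apply: (@le_trans _ _ (K * e ^+ 2 + 2 * (E * N%:R ^- 2 +
    4 * (K * e ^+ 2 + B * N%:R ^+ 2) * N%:R ^- 8))).
  apply: (msq_sub_const (@mA N) (lD N)) => //.
  - by near: N; exact: tail_probability_le.
  - by near: N; exact: hN8.
  - by near: N; exact: hB.
  - by near: N; exact: hE.
have e1 : (K * e ^+ 2) * N%:R ^- 8 <= K * e ^+ 2 * N%:R ^- 2.
  by rewrite ler_pM2l// lef_pV2 ?posrE ?exprn_gt0// ler_weXn2l.
have e2 : B * N%:R ^+ 2 * N%:R ^- 8 <= B * N%:R ^- 2.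
  rewrite -mulrA ler_wpM2l//.
  have -> : N%:R ^+ 2 * N%:R ^- 8 = N%:R ^- 6 :> R by field; rewrite gt_eqF.
  by rewrite lef_pV2 ?posrE ?exprn_gt0// ler_weXn2l.
have e3 : C * N%:R ^- 2 <= K * e ^+ 2.
  by rewrite mulrC -ler_pdivlMr//; near: N.
move: e3; rewrite /C -(mulrA 2 K).
move: (N%:R ^- 2) (N%:R ^- 8) (K * e ^+ 2) e1 e2 => s t v e1 e2; lra.
Unshelve. all: by end_near. Qed.

(** The resolvent function has a bounded derivative on the whole line, so the variance bound applies
    to it directly and is uniform in [N], whereas [tame] allows growth. *)
Lemma msq_resolvent_center z : complex.Im z != 0 -> forall N,
  exists c, msq (P N) (fun w => Y z N w - c) <= K * `|complex.Im z| ^- 4.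
Proof.
move=> z0 N; exists (cexpect (P N) (Y z N)).
have lY := L2_tr_resolvent (P := P N) (@mX N) (@hX N) z0.
have [_ iYc] : L2 (P N) (fun w => Y z N w - cexpect (P N) (Y z N)).
  by apply: L2B => //; exact: L2_cst.
rewrite -lee_fin; apply: (@le_trans _ _ (cvar (P N) (Y z N))).
  rewrite /cvar unlock /msq /Rintegral fineK//.
  exact: integrable_fin_num iYc.
have -> : Y z N = (fun w => trace_fun (resolvent z) (X N w)).
  by apply/funext => w; rewrite /Y mxtrace_resolvent.
apply: le_trans (var_bound N (C1_resolvent z0)) _.
have sup : (supnorm setT (cderiv (resolvent z)) <= (`|complex.Im z| ^- 2)%:E)%E.
  apply: supnorm_le => x _; rewrite (cderivE (is_cderive_resolvent z0)).
  exact: normc_resolvent_sqr_le.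
have sup0 : (0 <= supnorm setT (cderiv (resolvent z)))%E.
  exact: (supnorm_ge0 _ (x := 0)).
rewrite EFinM lee_pmul ?lee_fin ?(ltW K_gt0)//; first by rewrite expe2 mule_ge0.
have -> : `|complex.Im z| ^- 4 = `|complex.Im z| ^- 2 * `|complex.Im z| ^- 2.
  by rewrite -invfM -exprD.
by rewrite expe2 EFinM lee_pmul.
Qed.

Lemma ccov_poly_cvg (p q : {poly R[i]}) :
  (fun N : nat => ccov (P N) (S p N) (S q N) : R[i]^o) @ \oo -->
  (\sum_(i < size p) \sum_(j < size q) p`_i * (q`_j * alpha2 i j) : R[i]^o).
Proof.
have lS N (r : {poly R[i]}) i : L2 (P N) (fun w => r`_i * \tr (X N w ^+ i)).
  exact: L2Z.
have E N : ccov (P N) (S p N) (S q N) = \sum_(i < size p) \sum_(j < size q)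
    p`_i * (q`_j * ccov (P N) (fun w => \tr (X N w ^+ i)) (fun w => \tr (X N w ^+ j))).
  rewrite ccov_suml//; last by apply: L2_sum.
  apply: eq_bigr => i _; rewrite ccovC ccov_suml//; apply: eq_bigr => j _.
  by rewrite ccovC ccovZl// ccovC ccovZl// ccovC.
under eq_fun do rewrite E.
apply: cvg_big => [|i _]; first exact: add_continuous.
apply: cvg_big => [|j _]; first exact: add_continuous.
apply: cvgM; first exact: cvg_cst.
by apply: cvgM; first exact: cvg_cst.
Qed.

(** The trace of the zeroth power is constant, so the covariances vanish already at finite [N]. *)
Lemma alpha2_0l n : alpha2 0 n = 0.
Proof.
apply/eqP/negPn/negP => a0.
have a_gt0 : 0 < Normc.normc (alpha2 0 n).
  rewrite lt_neqAle normc_ge0 andbT eq_sym; apply: contra a0 => /eqP.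
  by move/Normc.eq0_normc => ->.
have [N _ /(_ N (leqnn N))] := (cvg_normcP _ _).1 (@cov_cvg 0 n) _ a_gt0.
have E : ccov (P N) (fun w => \tr (X N w ^+ 0)) (fun w => \tr (X N w ^+ n)) = 0.
  exact: (ccov_cstl (\tr 1) (L2X N n)).
by rewrite E subr0 ltxx.
Qed.

Lemma alpha2_0r m : alpha2 m 0 = 0.
Proof.
apply/eqP/negPn/negP => a0.
have a_gt0 : 0 < Normc.normc (alpha2 m 0).
  rewrite lt_neqAle normc_ge0 andbT eq_sym; apply: contra a0 => /eqP.
  by move/Normc.eq0_normc => ->.
have [N _ /(_ N (leqnn N))] := (cvg_normcP _ _).1 (@cov_cvg m 0) _ a_gt0.
have E : ccov (P N) (fun w => \tr (X N w ^+ m)) (fun w => \tr (X N w ^+ 0)) = 0.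
  by rewrite ccovC; exact: (ccov_cstl (\tr 1) (L2X N m)).
by rewrite E subr0 ltxx.
Qed.

(** The difference is a covariance of [D] with [Y w] plus one of [D'] with [S p]. In each, the first
    factor has mean square of order [e ^+ 2] and the second is bounded uniformly in [N], so
    [ccov_le] with weight [e^-1] yields order [e]. *)
Lemma ccov_resolvent_poly_le z w (p q : {poly R[i]}) (e : R) :
  complex.Im z != 0 -> complex.Im w != 0 -> 0 < e -> e <= 1 ->
  (forall x, - M <= x <= M ->
    Normc.normc (resolvent z x ^+ 2 - p^`().[x%:C]) <= e) ->
  (forall x, - M <= x <= M ->
    Normc.normc (resolvent w x ^+ 2 - q^`().[x%:C]) <= e) ->
  \forall N \near \oo,
    Normc.normc (ccov (P N) (Y z N) (Y w N) - ccov (P N) (S p N) (S q N)) <=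
    e * (2 * (2 * K + K * `|complex.Im w| ^- 4) +
         2 * (2 * K + 2 * (K * `|complex.Im z| ^- 4 + 2 * K))).
Proof.
move=> z0 w0 e0 e1 pe qe.
apply: filterS2 (msq_resolventB_le z0 e0 pe) (msq_resolventB_le w0 e0 qe).
move=> N [c hc] [c' hc'].
have [a ha] := msq_resolvent_center z0 N.
have [b hb] := msq_resolvent_center w0 N.
have lYz := L2_tr_resolvent (P := P N) (@mX N) (@hX N) z0.
have lYw := L2_tr_resolvent (P := P N) (@mX N) (@hX N) w0.
have [/(_ N) lSp _ _] := tame_tr_poly p; have [/(_ N) lSq _ _] := tame_tr_poly q.
pose D x := Y z N x - S p N x; pose D' x := Y w N x - S q N x.
have lD : L2 (P N) D by exact: L2B.
have lD' : L2 (P N) D' by exact: L2B.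
have YzE : Y z N = (fun x => D x + S p N x) by apply/funext => x; rewrite subrK.
have YwE : Y w N = (fun x => D' x + S q N x) by apply/funext => x; rewrite subrK.
have -> : ccov (P N) (Y z N) (Y w N) - ccov (P N) (S p N) (S q N) =
    ccov (P N) D (Y w N) + ccov (P N) D' (S p N).
  have -> : ccov (P N) (Y z N) (Y w N) =
      ccov (P N) D (Y w N) + ccov (P N) (S p N) (Y w N).
    by rewrite -(ccovDl lD lSp lYw) -YzE.
  have -> : ccov (P N) (S p N) (Y w N) =
      ccov (P N) (S p N) D' + ccov (P N) (S p N) (S q N).
    by rewrite -(ccovDr lD' lSq lSp) -YwE.
  by rewrite (ccovC _ D') addrA addrK.
have ei0 : 0 < e^-1 by rewrite invr_gt0.
have ee : e^-1 * (2 * K * e ^+ 2) = e * (2 * K) by field; rewrite gt_eqF.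
(* The variance bound does not reach [S p] itself, so it is centred as the difference of [Y z] about
   [a] and [D] about [c]. The assumption [e <= 1] makes the bound independent of [e]. *)
have hS : msq (P N) (fun x => S p N x - (a - c)) <=
    2 * (K * `|complex.Im z| ^- 4 + 2 * K).
  rewrite (_ : (fun x => _) = fun x => (Y z N x - a) + -1 * (D x - c)); last first.
    by apply/funext => x; rewrite /D; ring.
  have l1 : L2 (P N) (fun x => Y z N x - a) by apply: L2B => //; exact: L2_cst.
  have l2 : L2 (P N) (fun x => D x - c) by apply: L2B => //; exact: L2_cst.
  apply: le_trans (msqD_le l1 (L2Z (-1) l2)) _.
  rewrite ler_pM2l// lerD//.
  rewrite [leLHS](msq_onZ (-1) measurableT l2) normcN Normc.normc1 expr1n mul1r.
  apply: le_trans hc _; rewrite ler_piMr ?mulr_ge0 ?(ltW K_gt0)//.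
  by rewrite expr_le1// ltW.
have b1 := ccov_le c b ei0 lD lYw; have b2 := ccov_le c' (a - c) ei0 lD' lSp.
rewrite invrK in b1 b2.
have u1 : e^-1 * msq (P N) (fun x => D x - c) <= e * (2 * K).
  by rewrite -ee ler_pM2l.
have u2 : e^-1 * msq (P N) (fun x => D' x - c') <= e * (2 * K).
  by rewrite -ee ler_pM2l.
have u3 : e * msq (P N) (fun x => Y w N x - b) <= e * (K * `|complex.Im w| ^- 4).
  by rewrite ler_pM2l.
have u4 : e * msq (P N) (fun x => S p N x - (a - c)) <=
    e * (2 * (K * `|complex.Im z| ^- 4 + 2 * K)) by rewrite ler_pM2l.
apply: le_trans (ler_normcD _ _) _; lra.
Qed.

Lemma ccov_resolvent_cvg (rho : segfun M -> segfun M -> R[i]) z w :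
  asymptotic_covariance K alpha2 rho ->
  complex.Im z != 0 -> complex.Im w != 0 ->
  (fun N : nat => ccov (P N) (Y z N) (Y w N) : R[i]^o) @ \oo -->
  (rho (restr M (resolvent z)) (restr M (resolvent w)) : R[i]^o).
Proof.
move=> rho_cov z0 w0; apply/cvg_normcP => e e0.
set l := rho _ _.
pose iz := `|complex.Im z| ^- 2; pose iw := `|complex.Im w| ^- 2.
pose B := 2 * (2 * K + K * `|complex.Im w| ^- 4) +
         2 * (2 * K + 2 * (K * `|complex.Im z| ^- 4 + 2 * K)).
pose C := B + K * (iw + iz + 1).
have b0 : 0 < B.
  have K0 := ltW K_gt0.
  rewrite ltr_pwDl//; last first.
    by rewrite !(mulr_ge0, addr_ge0) ?invr_ge0 ?exprn_ge0.
  by rewrite mulr_gt0// ltr_pwDl ?mulr_gt0// mulr_ge0 ?invr_ge0 ?exprn_ge0.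
have C0 : 0 < C.
  by rewrite ltr_pwDl// mulr_ge0 ?(ltW K_gt0)// !addr_ge0 ?invr_ge0 ?exprn_ge0.
(* Both approximation errors are linear in [t], with total constant [C] as long as [t <= 1]; they
   use one third of [e], and the polynomial covariances another. *)
pose t := Num.min 1 (e / (3 * C)).
have t0 : 0 < t by rewrite /t lt_min ltr01 divr_gt0// mulr_gt0.
have t1 : t <= 1 by rewrite /t ge_min lexx.
have tC : t * C <= e / 3.
  apply: (@le_trans _ _ (e / (3 * C) * C)).
    by rewrite ler_pM2r// /t ge_min lexx orbT.
  by rewrite le_eqVlt; apply/orP; left; apply/eqP; field; rewrite gt_eqF.
have [p pt] := resolvent_approx M_gt0 t0 z0.
have [q qt] := resolvent_approx M_gt0 t0 w0.
have hrho := rho_approx M_gt0 (ltW K_gt0) rho_cov alpha2_0r alpha2_0l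
  z0 w0 (ltW t0) pt qt.
have e3 : 0 < e / 3 by rewrite divr_gt0.
have := (cvg_normcP _ _).1 (@ccov_poly_cvg p q) _ e3.
have := ccov_resolvent_poly_le z0 w0 t0 t1 pt qt.
apply: filterS2 => N; rewrite -/B -/l -/iz -/iw in hrho *.
set L := \sum_(i < _) _ in hrho *; set u := ccov _ (Y z N) _; set v := ccov _ _ _.
move=> huv hLv.
have -> : l - u = (l - L) + (L - v) - (u - v) by ring.
apply: le_lt_trans (ler_normcB _ _) _.
apply: le_lt_trans (lerD (ler_normcD _ _) (lexx _)) _.
have h1 : K * t * (iw + iz + t) <= t * (K * (iw + iz + 1)).
  by rewrite mulrCA mulrA ler_pM2l ?mulr_gt0// lerD2l.
have h2 : t * B + t * (K * (iw + iz + 1)) <= e / 3 by rewrite -mulrDr.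
clear - hrho huv hLv h1 h2 e0; clearbody L u v l iz iw B t; lra.
Qed.

End Asymptotics.

Unset Implicit Arguments.


Theorem corollary8 (R : realType) (d : nat -> measure_display)
  (T : forall N : nat, measurableType (d N))
  (P : forall N : nat, probability (T N) R)
  (X : forall N : nat, T N -> 'M[R[i]]_N)
  (M K : R)
  (alpha1 : nat -> R[i]) (alpha2 : nat -> nat -> R[i])
  (rho : segfun M -> segfun M -> R[i])
  (M_gt0 : 0 < M) (K_gt0 : 0 < K)
  (X_ensemble : self_adjoint_ensemble P X)
  (moment_cvg : forall n : nat,
    (fun N : nat => N%:R^-1 * cexpect (P N) (fun w => \tr (X N w ^+ n)) : R[i]^o)
      @ \oo --> (alpha1 n : R[i]^o))
  (cov_cvg : forall m n : nat,
    (fun N : nat =>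
       ccov (P N) (fun w => \tr (X N w ^+ m)) (fun w => \tr (X N w ^+ n)) : R[i]^o)
      @ \oo --> (alpha2 m n : R[i]^o))
  (tail : (fun N : nat =>
       ((N%:R ^+ 8)%:E * P N [set w | (M < opnorm (X N w))%R])%E)
      @ \oo --> (0%E : \bar R))
  (var_bound : forall (f : R -> R[i]) (N : nat), C1 f ->
    (cvar (P N) (fun w => trace_fun f (X N w)) <=
       K%:E * supnorm setT (cderiv f) ^+ 2)%E)
  (rho_cov : asymptotic_covariance K alpha2 rho)
  (z w : R[i]) (z_nonreal : complex.Im z != 0) (w_nonreal : complex.Im w != 0) :
  (fun N : nat =>
     ccov (P N) (fun t => \tr (invmx (z%:M - X N t)))
                (fun t => \tr (invmx (w%:M - X N t))) : R[i]^o)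
    @ \oo --> (rho (restr M (resolvent z)) (restr M (resolvent w)) : R[i]^o).
Proof.
exact: (ccov_resolvent_cvg M_gt0 K_gt0 X_ensemble moment_cvg cov_cvg tail
  var_bound rho_cov z_nonreal w_nonreal).
Qed.
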